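(* Let $D$ be an integral domain that is not a field, with quotient field $K$, let $\Theta$ be a pre-Jaffard family of $D$, and let $\{\mathcal{N}^\alpha(\Theta)\}_\alpha$ and $\{T_\alpha\}_\alpha$ be the associated sequences (defined in the context). Let $\alpha$ be an ordinal. If $\mathrm{Inv}(T)$ is free for every $T\in\Theta\setminus\mathcal{N}^\alpha(\Theta)$, then there is an exact sequence $$0\longrightarrow\bigoplus_{T\in\Theta\setminus\mathcal{N}^\alpha(\Theta)}\mathrm{Inv}(T)\longrightarrow\mathrm{Inv}(D)\longrightarrow\mathrm{Inv}(T_\alpha)\longrightarrow 0.$$ In particular, if moreover $\Theta$ is sharp with Jaffard degree at most $\alpha$, then $\mathrm{Inv}(D)\simeq\bigoplus_{T\in\Theta}\mathrm{Inv}(T)$, and $\mathrm{Inv}(D)$ is free.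
   Context: $\mathrm{Inv}(A)$ denotes the group of invertible fractional ideals of an integral domain $A$ under multiplication (trivial if $A$ is a field). ''Free'' means free abelian. An overring of $D$ is a ring between $D$ and $K$; it is flat if it is flat as a $D$-module. A family $\Theta$ of overrings of $D$ is: complete if $I=\bigcap\{IT\mid T\in\Theta\}$ for every fractional ideal $I$ of $D$; independent if for all $T\neq S$ in $\Theta$ there is no nonzero prime ideal $P$ of $D$ with $PT\neq T$ and $PS\neq S$; locally finite if for every nonzero $x\in D$, $xT=T$ for all but finitely many $T\in\Theta$. The Zariski topology on the set $\mathrm{Over}(D)$ of overrings of $D$ is generated by the sets $\{T\in\mathrm{Over}(D)\mid x\in T\}$, $x\in K$. A Jaffard family of $D$ is a family of flat overrings of $D$ that is complete, independent and locally finite and does not contain $K$. A Jaffard overring of $D$ is an overring belonging to some Jaffard family of $D$. A pre-Jaffard family of $D$ is a family of flat overrings of $D$ that is complete, independent, compact in the Zariski topology of $\mathrm{Over}(D)$, and does not contain $K$. Given a pre-Jaffard family $\Theta$ of $D$, define by transfinite recursion: $\mathcal{N}^0(\Theta):=\Theta$, $T_0:=D$; if $\alpha=\gamma+1$, $\mathcal{N}^\alpha(\Theta)$ is the set of members of $\mathcal{N}^\gamma(\Theta)$ that are not Jaffard overrings of $T_\gamma$; if $\alpha$ is a limit ordinal, $\mathcal{N}^\alpha(\Theta):=\bigcap_{\gamma<\alpha}\mathcal{N}^\gamma(\Theta)$; and $T_\alpha:=\bigcap\{T\mid T\in\mathcal{N}^\alpha(\Theta)\}$ (with $T_\alpha=K$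 if $\mathcal{N}^\alpha(\Theta)=\emptyset$). Each $\mathcal{N}^\alpha(\Theta)$ is a pre-Jaffard family of $T_\alpha$. The family $\Theta$ is sharp if $T_\alpha=K$ for some $\alpha$; in that case its Jaffard degree is the least such $\alpha$. *)

(* Defs.v *)
From HB Require Import structures.
From mathcomp Require Import all_boot all_order all_algebra ring_quotient.
From mathcomp Require Import all_classical topology.
From mathcomp Require wochoice.

Set Implicit Arguments.
Unset Strict Implicit.
Unset Printing Implicit Defensive.

Import GRing.Theory.

Local Open Scope classical_set_scope.
Local Open Scope ring_scope.

Section DirectSum.
Variables (I : Type) (G : I -> zmodType).

Record dsum := Dsum {
  dsum_fun :> forall i, G i;
  dsum_finite : finite_set [set i | dsum_fun i != 0] }.

Lemma dsum_ext (u v : dsum) : (forall i, u i = v i) -> u = v.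
Proof.
case: u v => [f hf] [g hg] /= e.
have {}e : f = g by apply: functional_extensionality_dep.
by rewrite e in hf *; congr Dsum; exact: Prop_irrelevance.
Qed.

Fact dsum0_finite : finite_set [set i | (0 : G i) != 0].
Proof. by apply: (sub_finite_set _ (finite_set0 I)) => i /=; rewrite eqxx. Qed.

Fact dsumN_finite (u : dsum) : finite_set [set i | - u i != 0].
Proof.
by apply: (sub_finite_set _ (dsum_finite u)) => i /=; rewrite oppr_eq0.
Qed.

Fact dsumD_finite (u v : dsum) : finite_set [set i | u i + v i != 0].
Proof.
apply: (sub_finite_set (B := [set i | u i != 0] `|` [set i | v i != 0])).
  move=> i /= h; have [u0|] := eqVneq (u i) 0; last by left.
  by right; rewrite u0 add0r in h.
by rewrite finite_setU; split; exact: dsum_finite.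
Qed.

HB.instance Definition _ := gen_eqMixin dsum.
HB.instance Definition _ := gen_choiceMixin dsum.

Fact dsumA : associative (fun u v => Dsum (dsumD_finite u v)).
Proof. by move=> u v w; apply: dsum_ext => i /=; rewrite addrA. Qed.

Fact dsumC : commutative (fun u v => Dsum (dsumD_finite u v)).
Proof. by move=> u v; apply: dsum_ext => i /=; rewrite addrC. Qed.

Fact dsum0 : left_id (Dsum dsum0_finite) (fun u v => Dsum (dsumD_finite u v)).
Proof. by move=> u; apply: dsum_ext => i /=; rewrite add0r. Qed.

Fact dsumN : left_inverse (Dsum dsum0_finite)
  (fun u => Dsum (dsumN_finite u)) (fun u v => Dsum (dsumD_finite u v)).
Proof. by move=> u; apply: dsum_ext => i /=; rewrite addNr. Qed.

HB.instance Definition _ := GRing.isZmodule.Build dsum dsumA dsumC dsum0 dsumN.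

End DirectSum.

Definition isomorphic (G H : zmodType) : Prop :=
  exists f : {additive G -> H}, bijective f.

Definition free_abelian (G : zmodType) : Prop :=
  exists B : Type, isomorphic (dsum (fun _ : B => int)) G.

Definition short_exact (F G H : zmodType)
    (f : {additive F -> G}) (g : {additive G -> H}) : Prop :=
  [/\ injective f, range f = [set x | g x = 0] & range g = setT].

(* An element of the tensor product of M and N over R is a formal sum of pure
   tensors, represented by the sequence of its terms; [tensor_eq] is equality
   in the tensor product, i.e. the least congruence on formal sums making
   (x, y) |-> x (x) y biadditive and R-balanced. *)
Inductive tensor_eq (R : comNzRingType) (M N : lmodType R) :
    seq (M * N) -> seq (M * N) -> Prop :=
  | Tensor_refl s : tensor_eq s s
  | Tensor_sym s t : tensor_eq s t -> tensor_eq t s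
  | Tensor_trans s t u : tensor_eq s t -> tensor_eq t u -> tensor_eq s u
  | Tensor_cat s s' t t' :
      tensor_eq s s' -> tensor_eq t t' -> tensor_eq (s ++ t) (s' ++ t')
  | Tensor_catC s t : tensor_eq (s ++ t) (t ++ s)
  | Tensor_0 y : tensor_eq [:: (0, y)] [::]
  | Tensor_Dl x x' y : tensor_eq [:: (x + x', y)] [:: (x, y); (x', y)]
  | Tensor_Dr x y y' : tensor_eq [:: (x, y + y')] [:: (x, y); (x, y')]
  | Tensor_Z (a : R) x y : tensor_eq [:: (a *: x, y)] [:: (x, a *: y)].

Definition flat (R : comNzRingType) (N : lmodType R) : Prop :=
  forall (M M' : lmodType R) (f : {linear M -> M'}), injective f ->
  forall s t : seq (M * N),
    tensor_eq [seq (f p.1, p.2) | p <- s] [seq (f p.1, p.2) | p <- t] ->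
    tensor_eq s t.

Lemma subring_ext (K : fieldType) (A B : subringClosed K) : A =i B -> A = B.
Proof.
case: A B => [a ca] [b cb] e.
have {}e : a = b by apply/funext => x; exact: e.
case: b / e cb => cb; congr GRing.SubringClosed.Pack.
case: ca cb => [[s1] [s2] [s3] [s4]] [[t1] [t2] [t3] [t4]].
by congr GRing.SubringClosed.Class; [congr Algebra.isOppClosed.Axioms_
  |congr Algebra.isAddClosed.Axioms_|congr GRing.isMul2Closed.Axioms_
  |congr GRing.isMul1Closed.Axioms_]; apply: Prop_irrelevance.
Qed.

Section Subrings.
Variable K : fieldType.
Implicit Types (A T : subringClosed K) (I J : set K).

Definition subring_type A : Type := {x : K | x \in A}.

HB.instance Definition _ A := SubChoice.on (subring_type A).
HB.instance Definition _ A := [SubChoice_isSubComNzRing of subring_type A by <:].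

Definition is_quotient_field A : Prop :=
  forall x : K, exists a b, [/\ a \in A, b \in A, b != 0 & x = a / b].

Definition is_field A : Prop := forall x, x \in A -> x != 0 -> x^-1 \in A.

Definition submodule A I : Prop :=
  [/\ I 0, forall x y, I x -> I y -> I (x + y)
    & forall a x, a \in A -> I x -> I (a * x)].

Definition fractional_ideal A I : Prop :=
  submodule A I /\
  exists d, [/\ d \in A, d != 0 & forall x, I x -> d * x \in A].

Definition mul_set I J : set K :=
  [set z | exists2 s : seq (K * K),
     forall p, p \in s -> I p.1 /\ J p.2 & z = \sum_(p <- s) p.1 * p.2].

Definition invertible A I : Prop :=
  fractional_ideal A I /\
  exists2 J, fractional_ideal A J & mul_set I J = [set` A].

(* The group of invertible fractional ideals, written additively so that it is
   a zmodType: the sum of two elements is the product of the ideals. *)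
Record InvIdeals A := MkInv { Inv_set :> set K; InvP : invertible A Inv_set }.

End Subrings.

Section InvGroup.
Variables (K : fieldType) (A : subringClosed K).
Implicit Types (I J L : set K).

Lemma Inv_ext (u v : InvIdeals A) : u = v :> set K -> u = v.
Proof.
case: u v => [I hI] [J hJ] /= e; rewrite e in hI *.
by congr MkInv; exact: Prop_irrelevance.
Qed.

Lemma mul_set_mem I J x y : I x -> J y -> mul_set I J (x * y).
Proof.
move=> Ix Jy; exists [:: (x, y)]; last by rewrite big_seq1.
by move=> p; rewrite inE => /eqP->.
Qed.

Lemma mul_setD I J x y :
  mul_set I J x -> mul_set I J y -> mul_set I J (x + y).
Proof.
move=> [s hs ->] [t ht ->]; exists (s ++ t); last by rewrite big_cat.
by move=> p; rewrite mem_cat => /orP[/hs|/ht].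
Qed.

Lemma mul_set0 I J : mul_set I J 0.
Proof. by exists [::]; rewrite ?big_nil. Qed.

Lemma mul_set_least I J (L : set K) :
  L 0 -> (forall x y, L x -> L y -> L (x + y)) ->
  (forall x y, I x -> J y -> L (x * y)) -> mul_set I J `<=` L.
Proof.
move=> L0 LD LM z [s hs ->]; elim: s hs => [|p s IHs] hs.
  by rewrite big_nil.
rewrite big_cons; apply: LD; first by apply: LM; have [] := hs p (mem_head _ _).
by apply: IHs => q qs; apply: hs; rewrite inE qs orbT.
Qed.

Lemma mul_setC I J : mul_set I J = mul_set J I.
Proof.
by apply/seteqP; split; apply: mul_set_least;
  [exact: mul_set0|exact: mul_setD|move=> x y ? ?; rewrite mulrC; exact: mul_set_mem
  |exact: mul_set0|exact: mul_setD|move=> x y ? ?; rewrite mulrC; exact: mul_set_mem].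
Qed.

Lemma mul_set_sub I J L :
  mul_set I (mul_set J L) `<=` mul_set (mul_set I J) L.
Proof.
apply: mul_set_least; [exact: mul_set0|exact: mul_setD|move=> x y Ix].
move: y; apply: (@mul_set_least _ _ [set y | mul_set (mul_set I J) L (x * y)]).
- by rewrite /= mulr0; exact: mul_set0.
- by move=> y z /= ? ?; rewrite mulrDr; exact: mul_setD.
- by move=> y z Jy Lz /=; rewrite mulrA; do !apply: mul_set_mem.
Qed.

Lemma mul_setA I J L : mul_set I (mul_set J L) = mul_set (mul_set I J) L.
Proof.
apply/seteqP; split; first exact: mul_set_sub.
rewrite (mul_setC _ L) (mul_setC I J) (mul_setC I _) (mul_setC J L).
exact: mul_set_sub.
Qed.

Lemma mul_set1 I : submodule A I -> mul_set [set` A] I = I.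
Proof.
move=> [I0 ID IZ]; apply/seteqP; split; first exact: mul_set_least.
by move=> x Ix; rewrite -[x]mul1r; apply: mul_set_mem => //=; exact: rpred1.
Qed.

Lemma mul_set_fractional I J :
  fractional_ideal A I -> fractional_ideal A J ->
  fractional_ideal A (mul_set I J).
Proof.
move=> [[I0 ID IZ] [c [cA c0 hc]]] [[J0 JD JZ] [d [dA d0 hd]]].
split; first split.
- exact: mul_set0.
- exact: mul_setD.
- move=> a x aA; move: x.
  apply: (@mul_set_least _ _ [set x | mul_set I J (a * x)]).
  + by rewrite /= mulr0; exact: mul_set0.
  + by move=> y z /= ? ?; rewrite mulrDr; exact: mul_setD.
  + by move=> y z Iy Jz /=; rewrite mulrA; apply: mul_set_mem => //; exact: IZ.
- exists (c * d); split; [exact: rpredM|by rewrite mulf_neq0|].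
  apply: (@mul_set_least _ _ [set x | c * d * x \in A]) => /=.
  + by rewrite mulr0 rpred0.
  + by move=> y z ? ?; rewrite mulrDr rpredD.
  + by move=> y z Iy Jz; rewrite mulrACA rpredM ?hc ?hd.
Qed.

Lemma subring_fractional : fractional_ideal A [set` A].
Proof.
split; first by split=> /= [|x y|a x]; [exact: rpred0|exact: rpredD|exact: rpredM].
by exists 1; split=> [||x]; rewrite ?rpred1 ?oner_neq0 // mul1r.
Qed.

Fact Inv0_subproof : invertible A [set` A].
Proof.
split; first exact: subring_fractional.
exists [set` A]; first exact: subring_fractional.
by apply: mul_set1; case: subring_fractional.
Qed.

Fact InvD_subproof (u v : InvIdeals A) : invertible A (mul_set u v).
Proof.
case: u v => [I [fI [I' fI' eI]]] [J [fJ [J' fJ' eJ]]] /=.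
split; first exact: mul_set_fractional.
exists (mul_set I' J'); first exact: mul_set_fractional.
rewrite mul_setA -(mul_setA I) (mul_setC J) mul_setA eI -mul_setA eJ.
by apply: mul_set1; case: subring_fractional.
Qed.

Definition colon I : set K := [set x | forall y, I y -> x * y \in A].

Lemma colonE I J : fractional_ideal A J -> mul_set I J = [set` A] ->
  colon I = J.
Proof.
move=> [[J0 JD JZ] _] e; apply/seteqP; split=> x.
  move=> hx; have : [set` A] 1 by exact: rpred1.
  rewrite -e => h1; rewrite -[x]mulr1; move: {h1} 1 h1.
  apply: (@mul_set_least _ _ [set y | J (x * y)]) => /=.
  - by rewrite mulr0.
  - by move=> y z ? ?; rewrite mulrDr; exact: JD.
  - by move=> y z Iy Jz; rewrite mulrA; apply: JZ => //; exact: hx.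
move=> Jx y Iy; have : mul_set I J (y * x) by exact: mul_set_mem.
by rewrite e mulrC.
Qed.

Lemma colonM (u : InvIdeals A) : mul_set (colon u) u = [set` A].
Proof. by case: u => [I [_ [J fJ e]]] /=; rewrite (colonE fJ e) mul_setC. Qed.

Fact InvN_subproof (u : InvIdeals A) : invertible A (colon u).
Proof.
case: u => [I [fI [J fJ e]]] /=; rewrite (colonE fJ e); split=> //.
by exists I => //; rewrite mul_setC.
Qed.

HB.instance Definition _ := gen_eqMixin (InvIdeals A).
HB.instance Definition _ := gen_choiceMixin (InvIdeals A).

Fact InvA : associative (fun u v => MkInv (InvD_subproof u v)).
Proof. by move=> u v w; apply: Inv_ext; exact: mul_setA. Qed.

Fact InvC : commutative (fun u v => MkInv (InvD_subproof u v)).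
Proof. by move=> u v; apply: Inv_ext; exact: mul_setC. Qed.

Fact Inv0 : left_id (MkInv Inv0_subproof) (fun u v => MkInv (InvD_subproof u v)).
Proof. by move=> u; apply: Inv_ext; apply: mul_set1; case: (InvP u) => -[]. Qed.

Fact InvN : left_inverse (MkInv Inv0_subproof)
  (fun u => MkInv (InvN_subproof u)) (fun u v => MkInv (InvD_subproof u v)).
Proof. by move=> u; apply: Inv_ext; exact: colonM. Qed.

HB.instance Definition _ := GRing.isZmodule.Build (InvIdeals A) InvA InvC Inv0 InvN.

End InvGroup.

Section OverringModule.
Variables (K : fieldType) (A T : subringClosed K) (AT : {subset A <= T}).

Definition overring_module : Type := let _ := AT in subring_type T.

HB.instance Definition _ := GRing.Zmodule.on overring_module.

Definition overring_scale (a : subring_type A) (t : overring_module) :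
  overring_module := (Sub (val a) (AT (valP a)) : subring_type T) * t.

Fact overring_scaleA a b t :
  overring_scale a (overring_scale b t) = overring_scale (a * b) t.
Proof. by apply: val_inj; rewrite /= mulrA. Qed.

Fact overring_scale1 : left_id 1 overring_scale.
Proof. by move=> t; apply: val_inj; rewrite /= mul1r. Qed.

Fact overring_scaleDr : right_distributive overring_scale +%R.
Proof. by move=> a t u; apply: val_inj; rewrite /= mulrDr. Qed.

Fact overring_scaleDl t : {morph overring_scale^~ t : a b / a + b}.
Proof. by move=> a b; apply: val_inj; rewrite /= mulrDl. Qed.

HB.instance Definition _ :=
  GRing.Zmodule_isLmodule.Build (subring_type A) overring_module
    overring_scaleA overring_scale1 overring_scaleDr overring_scaleDl.

End OverringModule.

Section Zariski.
Variables (K : fieldType) (D : subringClosed K).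

Definition Over : Type := {T : subringClosed K | `[< {subset D <= T} >]}.

HB.instance Definition _ := gen_eqMixin Over.
HB.instance Definition _ := gen_choiceMixin Over.
HB.instance Definition _ := isSubBaseTopological.Build Over
  (range (fun x : K => [set T : Over | x \in sval T])) id.

End Zariski.

Section Families.
Variables (K : fieldType) (D : subringClosed K).
Implicit Types (T S : subringClosed K) (Theta : set (subringClosed K)).

Definition flat_overring T : Prop :=
  exists DT : {subset D <= T}, flat (overring_module DT).

Definition complete_family Theta : Prop :=
  forall I, fractional_ideal D I ->
    I = \bigcap_(T in Theta) mul_set I [set` T].

Definition extension (P : prime_idealr (subring_type D)) T : set K :=
  mul_set [set val x | x in [set` P]] [set` T].

Definition independent_family Theta : Prop :=
  forall T S, Theta T -> Theta S -> T <> S ->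
  ~ exists P : prime_idealr (subring_type D),
      [/\ exists2 x, x \in P & x != 0,
          extension P T <> [set` T] & extension P S <> [set` S]].

Definition locally_finite_family Theta : Prop :=
  forall x, x \in D -> x != 0 ->
    finite_set [set T | Theta T /\ [set x * t | t in [set` T]] <> [set` T]].

Definition Jaffard_family Theta : Prop :=
  [/\ forall T, Theta T -> flat_overring T,
      complete_family Theta, independent_family Theta,
      locally_finite_family Theta
    & forall T, Theta T -> [set` T] <> setT].

Definition Jaffard_overring T : Prop :=
  exists2 Theta, Jaffard_family Theta & Theta T.

Definition pre_Jaffard_family Theta : Prop :=
  [/\ forall T, Theta T -> flat_overring T,
      complete_family Theta, independent_family Theta,
      compact [set T : Over D | Theta (sval T)]
    & forall T, Theta T -> [set` T] <> setT].

End Families.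

Section Intersection.
Variables (K : fieldType) (Theta : set (subringClosed K)).

Definition bigcap_subring : {pred K} :=
  [pred x | `[< forall T : subringClosed K, Theta T -> x \in T >]].

Fact bigcap_subring_closed : subring_closed bigcap_subring.
Proof.
split=> [|x y /asboolP hx /asboolP hy|x y /asboolP hx /asboolP hy];
  apply: asboolT => T hT.
- exact: rpred1.
- by rewrite rpredB ?hx ?hy.
- by rewrite rpredM ?hx ?hy.
Qed.

HB.instance Definition _ :=
  GRing.isSubringClosed.Build K bigcap_subring bigcap_subring_closed.

End Intersection.

(* Ordinals are represented as elements of well-ordered types: an element a
   stands for the order type of its initial segment {b | b < a}, and every
   ordinal arises in this way. *)
Section WellOrder.
Variables (W : Type) (le : rel W).
Implicit Types a b c : W.

Definition wlt : rel W := fun a b => ~~ le b a.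
Definition is_zero a : Prop := forall b, ~~ wlt b a.
Definition is_succ c a : Prop := wlt c a /\ forall b, wlt b a -> le b c.
Definition is_limit a : Prop := ~ is_zero a /\ forall c, ~ is_succ c a.

Hypothesis wo : wochoice.well_order le.

Lemma wlt_wf : well_founded wlt.
Proof.
move=> a; apply: contrapT => na.
pose X := [pred x | `[< ~ Acc wlt x >]].
have /wo [m [[/asboolP mX mle] _]] : wochoice.nonempty X by exists a; apply/asboolP.
apply: mX; constructor => b hb; apply: contrapT => nb.
by move: hb; rewrite /wlt mle //; exact/asboolP.
Qed.

End WellOrder.

(* [derived] and [derived_ring] are the sequences N^a(Theta) and T_a; see
   [derived_zero], [derived_succ] and [derived_limit]. *)
Section DerivedSequence.
Variables (K : fieldType) (D : subringClosed K) (Theta : set (subringClosed K)).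
Variables (W : Type) (le : rel W) (wo : wochoice.well_order le).

Let family := set (subringClosed K).

Definition ring_of (a : W) (N : family) : subringClosed K :=
  if `[< is_zero le a >] then D else bigcap_subring N.

Definition derived_step (a : W) (N : forall c, wlt le c a -> family) : family :=
  [set T | [/\ is_zero le a -> Theta T,
      forall c (ca : wlt le c a), is_succ le c a ->
        N c ca T /\ ~ Jaffard_overring (ring_of c (N c ca)) T
    & is_limit le a -> forall c (ca : wlt le c a), N c ca T]].

Definition derived : W -> family :=
  Fix (wlt_wf wo) (fun=> family) derived_step.

Definition derived_ring (a : W) : subringClosed K := ring_of a (derived a).

Lemma derived_unfold a : derived a = derived_step (fun c (_ : wlt le c a) => derived c).
Proof.
rewrite /derived Fix_eq // => b f g fg; congr derived_step.
by do 2!apply: functional_extensionality_dep => ?; exact: fg.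
Qed.

Lemma derived_zero a : is_zero le a -> derived a = Theta.
Proof.
move=> a0; rewrite derived_unfold; apply/seteqP; split=> T /=; first by case=> /(_ a0).
by move=> hT; split=> // [c ca|[]//]; have := a0 c; rewrite ca.
Qed.

Lemma derived_succ c a : is_succ le c a ->
  derived a = [set T | derived c T /\ ~ Jaffard_overring (derived_ring c) T].
Proof.
move=> ca; rewrite derived_unfold; apply/seteqP; split=> T /=.
  by case=> _ /(_ c ca.1 ca).
move=> hT; split=> [a0|b ba ha|[_ /(_ c)]//].
  by have := a0 c; rewrite ca.1.
suff -> : b = c by [].
have anti x y : le x y -> le y x -> x = y.
  move=> xy yx; pose X := [pred z | `[< z = x \/ z = y >]].
  have Xx : x \in X by apply/asboolP; left.
  have Xy : y \in X by apply/asboolP; right.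
  have refl z : le z z.
    have /wo [m [[/asboolP -> h] _]] : wochoice.nonempty [pred w | `[< w = z >]].
      by exists z; apply/asboolP.
    by apply: h; apply/asboolP.
  have /wo [m [_ mu]] : wochoice.nonempty X by exists x.
  rewrite -(mu x); last by split=> // z /asboolP[]->.
  by rewrite -(mu y)//; split=> // z /asboolP[]->.
by apply: anti; [exact: ca.2 ba|exact: ha.2 ca.1].
Qed.

Lemma derived_limit a : is_limit le a ->
  derived a = \bigcap_(c in [set c | wlt le c a]) derived c.
Proof.
move=> al; rewrite derived_unfold; apply/seteqP; split=> T /=.
  by case=> _ _ /(_ al) h c ca; exact: h.
move=> h; split=> [/al.1//|c ca /al.2//|_ c ca]; exact: h.
Qed.

Definition is_Jaffard_degree (a : W) : Prop :=
  [set` derived_ring a] = setT /\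
  forall b, [set` derived_ring b] = setT -> le a b.

End DerivedSequence.

Definition sharp (K : fieldType) (D : subringClosed K)
    (Theta : set (subringClosed K)) : Prop :=
  exists (W : Type) (le : rel W) (wo : wochoice.well_order le) (a : W),
    [set` derived_ring D Theta wo a] = setT.

(* Main.v *)
Require Import Defs.
From HB Require Import structures.
From mathcomp Require Import all_boot all_order all_algebra ring_quotient.
From mathcomp Require Import finmap all_classical topology.
From mathcomp Require wochoice.

(* Proof idea. A member T of N^r(Theta) which is a Jaffard overring of T_r has a
   complement: K = T + S, where S is the intersection of the other members of
   N^r(Theta), and T and S meet in T_r. So an ideal of T_r can be modified at T
   without changing it at the other members of N^r(Theta). The same splitting
   makes the tails N^a(Theta) complete over T_a and, the family being compact,
   shows that an invertible ideal (more generally a finite subset of K) which is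
   trivial on N^a(Theta) is trivial on N^d(Theta) up to finitely many members of
   rank d, for some d < a, if it is not trivial on all of Theta. By well-founded
   induction on a, with finitely many modifications at each step, every
   invertible ideal of T_a lifts to an invertible ideal of D, and the invertible
   ideals of D trivial on N^a(Theta) are generated by lifts of elements of the
   groups Inv(T). Freeness makes the lifting homomorphic on each Inv(T), and the
   ranks make the resulting map on the direct sum triangular, hence injective. *)

Set Implicit Arguments.
Unset Strict Implicit.
Unset Printing Implicit Defensive.

Import GRing.Theory.

Local Open Scope classical_set_scope.
Local Open Scope ring_scope.

(** * Extension of ideals to overrings *)

Local Notation ext I T := (mul_set I [set` T]).

Section Extension.
Variable K : fieldType.
Implicit Types (A B T S : subringClosed K) (I J L : set K).

Lemma mul_setS I I' J J' : I `<=` I' -> J `<=` J' -> mul_set I J `<=` mul_set I' J'.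
Proof.
move=> sI sJ; apply: mul_set_least; [exact: mul_set0|exact: mul_setD|].
by move=> x y /sI ? /sJ ?; exact: mul_set_mem.
Qed.

Lemma sub_ext I T : I `<=` ext I T.
Proof. by move=> x Ix; rewrite -[x]mulr1; apply: mul_set_mem => //=; exact: rpred1. Qed.

Lemma extZ I T t x : t \in T -> ext I T x -> ext I T (t * x).
Proof.
move=> tT; move: x; apply: (@mul_set_least _ _ _ [set x | ext I T (t * x)]) => /=.
- by rewrite mulr0; exact: mul_set0.
- by move=> x y ? ?; rewrite mulrDr; exact: mul_setD.
- by move=> x y Ix Ty; rewrite mulrCA; apply: mul_set_mem => //=; exact: rpredM.
Qed.

Lemma ext_submodule I T : submodule T (ext I T).
Proof. by split; [exact: mul_set0|exact: mul_setD|move=> *; exact: extZ]. Qed.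

Lemma submodule_sub A T I : {subset A <= T} -> submodule T I -> submodule A I.
Proof. by move=> AT [? ? IZ]; split=> // a x /AT; exact: IZ. Qed.

Lemma ext_least I L T : submodule T L -> I `<=` L -> ext I T `<=` L.
Proof.
move=> [L0 LD LZ] sIL; apply: mul_set_least => // x t /sIL Lx tT.
by rewrite mulrC; exact: LZ.
Qed.

Lemma submodule_subring A T : {subset A <= T} -> submodule A [set` T].
Proof.
by move=> AT; apply: (submodule_sub AT); case: (subring_fractional T).
Qed.

Lemma ext_ext I A T : {subset A <= T} -> ext (ext I A) T = ext I T.
Proof.
move=> AT; rewrite -mul_setA; congr mul_set.
by rewrite mul_set1 //; exact: submodule_subring.
Qed.

Lemma ext_subring A T : {subset A <= T} -> ext [set` A] T = [set` T].
Proof. by move=> AT; rewrite mul_set1 //; exact: submodule_subring. Qed.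

Lemma ext_mul I J T : ext (mul_set I J) T = mul_set (ext I T) (ext J T).
Proof.
rewrite mul_setA -[in RHS](mul_setA I) (mul_setC [set` T] J) mul_setA.
by rewrite -[in RHS]mul_setA ext_subring.
Qed.

Lemma ext_eq1 I T : I `<=` [set` T] -> ext I T 1 -> ext I T = [set` T].
Proof.
move=> IT I1; apply/seteqP; split; first exact: ext_least (submodule_subring _) IT.
by move=> t tT; rewrite -[t]mulr1; exact: extZ.
Qed.

Lemma fractional_ext A T I : {subset A <= T} -> fractional_ideal A I ->
  fractional_ideal T (ext I T).
Proof.
move=> AT [_ [d [dA d0 hd]]]; split; first exact: ext_submodule.
exists d; split => //; first exact: AT.
move=> x; move: x; apply: (@mul_set_least _ _ _ [set x | d * x \in T]) => /=.
- by rewrite mulr0 rpred0.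
- by move=> x y ? ?; rewrite mulrDr rpredD.
- by move=> x t Ix tT; rewrite mulrA rpredM //; exact/AT/hd.
Qed.

Definition nonzero I := exists2 x, I x & x != 0.

Lemma nonzeroS I J : I `<=` J -> nonzero I -> nonzero J.
Proof. by move=> sIJ [x /sIJ ? ?]; exists x. Qed.

Lemma nonzero_mul I J : nonzero I -> nonzero J -> nonzero (mul_set I J).
Proof.
move=> [x Ix x0] [y Jy y0]; exists (x * y); first exact: mul_set_mem.
by rewrite mulf_neq0.
Qed.

Lemma invertible_nonzero A I : invertible A I -> nonzero I.
Proof.
move=> [_ [J _ e]]; apply: contrapT => h.
have: mul_set I J `<=` [set 0].
  apply: mul_set_least => //= [x y -> ->|x y Ix _]; first by rewrite addr0.
  have [->|x0] := eqVneq x 0; first by rewrite mul0r.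
  by case: h; exists x.
rewrite e => /(_ 1) /= h1; have /eqP := h1 (rpred1 _).
by rewrite oner_eq0.
Qed.

Lemma invertible_ext A T I : {subset A <= T} -> invertible A I ->
  invertible T (ext I T).
Proof.
move=> AT [fI [J fJ e]]; split; first exact: fractional_ext fI.
exists (ext J T); first exact: fractional_ext fJ.
by rewrite -ext_mul e ext_subring.
Qed.

Definition inv_ext A T (AT : {subset A <= T}) (I : InvIdeals A) : InvIdeals T :=
  MkInv (invertible_ext AT (InvP I)).

Fact inv_ext_additive A T (AT : {subset A <= T}) :
  zmod_morphism (inv_ext AT).
Proof.
have extD (u v : InvIdeals A) : inv_ext AT (u + v) = inv_ext AT u + inv_ext AT v.
  by apply: Inv_ext; exact: ext_mul.
move=> u v; apply: (addIr (inv_ext AT v)).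
by rewrite -extD subrK subrK.
Qed.

HB.instance Definition _ A T (AT : {subset A <= T}) :=
  GRing.isZmodMorphism.Build (InvIdeals A) (InvIdeals T) (inv_ext AT)
    (inv_ext_additive AT).

Lemma inv_ext_eq0 A T (AT : {subset A <= T}) (u : InvIdeals A) :
  inv_ext AT u = 0 <-> ext u T = [set` T].
Proof. by split=> [/(congr1 (@Inv_set K T))|e] //; exact: Inv_ext. Qed.

Lemma inv_ext0_sub A T (AT : {subset A <= T}) (u : InvIdeals A) :
  u `<=` [set` T] -> Inv_set (- u) `<=` [set` T] ->
  inv_ext AT u = 0.
Proof.
move=> uT NuT; apply/inv_ext_eq0/ext_eq1 => //.
have : Inv_set (u - u) 1 by rewrite subrr; exact: rpred1.
exact: mul_setS.
Qed.

Definition den A (ys : seq K) : set K :=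
  [set e | e \in A /\ forall y, y \in ys -> e * y \in A].

(* Richman's criterion for the flatness of an overring. *)
Definition clears A T := forall y, y \in T -> ext (den A [:: y]) T 1.

(** The product of the denominator ideals of the single elements is contained in [den A ys], and it
    extends to the unit ideal of [T] because each factor does. *)
Lemma clears_seq A T ys : clears A T -> {subset ys <= T} -> ext (den A ys) T 1.
Proof.
move=> cl; elim: ys => [|y ys IHys] sT.
  by apply: sub_ext; split=> //; exact: rpred1.
have /IHys h1 : {subset ys <= T} by move=> z zs; rewrite sT // inE zs orbT.
have /cl h2 : y \in T by rewrite sT ?mem_head.
have := mul_set_mem h2 h1; rewrite mulr1 -ext_mul; apply: mul_setS => //.
apply: mul_set_least.
- by split=> [|z _]; rewrite ?mul0r rpred0.
- by move=> c d [cA hc] [dA hd]; split=> [|z zs];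
    rewrite ?mulrDl rpredD ?hc ?hd.
- move=> c d [cA hc] [dA hd]; split=> [|z]; first exact: rpredM.
  rewrite inE => /orP[/eqP->|zs]; last by rewrite -mulrA rpredM ?hd.
  by rewrite mulrAC rpredM // hc ?inE.
Qed.

Lemma clearsW A B T : {subset A <= B} -> {subset B <= T} -> clears A T -> clears B T.
Proof.
move=> AB BT cl y /cl; apply: mul_setS => // e [eA he]; split; first exact: AB.
by move=> z /he/AB.
Qed.

End Extension.

(** * Flat overrings *)

Section TwoGeneratedIdeal.
Variables (R : comNzRingType) (a b : R).

Definition ideal2 : {pred R^o} :=
  [pred x : R | `[< exists r s, x = r * a + s * b >]].

Fact ideal2_submod_closed : submod_closed ideal2.
Proof.
split; first by apply/asboolP; exists 0, 0; rewrite !mul0r addr0.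
move=> c x y /asboolP[r [s ->]] /asboolP[r' [s' ->]]; apply/asboolP.
exists (c * r + r'), (c * s + s').
by rewrite /GRing.scale /= !mulrDl mulrDr !mulrA addrACA.
Qed.

HB.instance Definition _ :=
  GRing.isSubmodClosed.Build R R^o ideal2 ideal2_submod_closed.

Definition ideal2_type : Type := {x : R^o | x \in ideal2}.
HB.instance Definition _ := SubChoice.on ideal2_type.
HB.instance Definition _ := [SubChoice_isSubLmodule of ideal2_type by <:].

Lemma ideal2_l : (a : R^o) \in ideal2.
Proof. by apply/asboolP; exists 1, 0; rewrite mul1r mul0r addr0. Qed.

Lemma ideal2_r : (b : R^o) \in ideal2.
Proof. by apply/asboolP; exists 0, 1; rewrite mul1r mul0r add0r. Qed.

(** Both pure tensors have the same image in the tensor product of [R] and [N], since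
    [a *: n = b *: m]; flatness is applied to the inclusion into [R] of the ideal generated by [a]
    and [b]. *)
Lemma flat_ideal2 (N : lmodType R) (n m : N) : flat N -> a *: n = b *: m ->
  tensor_eq [:: (Sub (a : R^o) ideal2_l : ideal2_type, n)]
            [:: (Sub (b : R^o) ideal2_r : ideal2_type, m)].
Proof.
move=> fl e; apply: (fl _ _ (val : {linear ideal2_type -> R^o}) val_inj) => /=.
have scal (c : R) (k : N) : tensor_eq [:: (c : R^o, k)] [:: (1 : R^o, c *: k)].
  have := Tensor_Z c (1 : R^o) k.
  by rewrite /(_ *: (1 : R^o)) /GRing.scale /= mulr1.
by apply: Tensor_trans (scal a n) _; rewrite e; apply/Tensor_sym/scal.
Qed.

End TwoGeneratedIdeal.

(* If [y = a / b] then [a (x) 1 = b (x) y] in the tensor product of the ideal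
   [(a, b)] and [T]. The coefficient of [a] is well defined modulo the
   denominators of [y], and the induced map sends this relation to [1 = 0]. *)
Lemma flat_clears (K : fieldType) (A T : subringClosed K) :
  is_quotient_field A -> flat_overring A T -> clears A T.
Proof.
move=> qA [AT fl] y yT; have [a [b [aA bA b0 ey]]] := qA y.
pose a' : subring_type A := Sub a aA; pose b' : subring_type A := Sub b bA.
pose y' : overring_module AT := (Sub y yT : subring_type T).
pose one : overring_module AT := (1 : subring_type T).
have e : a' *: one = b' *: y'.
  by apply: val_inj; rewrite /= mulr1 ey mulrCA mulfV ?mulr1.
have /choice[c hc] : forall x : ideal2_type a' b', exists r : K,
    r \in A /\ exists2 s, s \in A & val (val x) = r * a + s * b.
  move=> x; have /asboolP[r [s er]] := valP x.
  by exists (val r); split; [exact: valP|exists (val s); [exact: valP|rewrite er]].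
set Q := den A [:: y].
have mQ : submodule T (ext Q T) by exact: ext_submodule.
have [Q0 QD QZ] := mQ.
have hQ r s : r \in A -> s \in A -> r * a + s * b = 0 -> Q r.
  move=> rA sA ers; split=> // z; rewrite inE => /eqP->.
  rewrite ey mulrA; suff -> : r * a = - s * b by rewrite mulfK // rpredN.
  by rewrite mulNr; apply/eqP; rewrite -addr_eq0 ers.
(* Coefficients of [a] in two representations of the same element differ by an element of [Q]; so
   [c] is linear modulo [Q]. *)
have cQ x r s : r \in A -> s \in A -> val (val x) = r * a + s * b -> Q (c x - r).
  move=> rA sA er; have [cA [s' s'A er']] := hc x.
  apply: (hQ _ (s' - s)); rewrite ?rpredB // !mulrBl addrACA -opprD -er -er'.
  by rewrite subrr.
pose phi (s : seq (ideal2_type a' b' * overring_module AT)) :=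
  \sum_(p <- s) c p.1 * val p.2.
have cT (n : overring_module AT) : val n \in T by case: n.
have QT q (n : overring_module AT) : Q q -> ext Q T (q * val n).
  by move=> Qq; exact: (mul_set_mem Qq (valP n)).
have key s t : tensor_eq s t -> ext Q T (phi s - phi t).
  elim=> {s t}.
  - move=> s; rewrite subrr; exact: Q0.
  - by move=> s t _ h; rewrite -opprB -mulN1r; apply: QZ => //; rewrite rpredN rpred1.
  - by move=> s t u _ h1 _ h2; have := QD _ _ h1 h2; rewrite addrA subrK.
  - move=> s s' t t' _ h1 _ h2; rewrite /phi !big_cat /= opprD addrACA; exact: QD.
  - move=> s t; rewrite /phi !big_cat /= [X in _ - X]addrC subrr; exact: Q0.
  - move=> n; rewrite /phi big_seq1 big_nil subr0 /=; apply: QT.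
    by rewrite -[c 0]subr0; apply: (cQ _ _ 0); rewrite ?rpred0 // !mul0r addr0.
  - move=> x x' n; rewrite /phi !big_cons !big_nil !addr0 /= -mulrDl -mulrBl; apply: QT.
    have [cA [s sA es]] := hc x; have [cA' [s' sA' es']] := hc x'.
    apply: (cQ _ _ (s + s')); rewrite ?rpredD //=.
    by rewrite es es' !mulrDl addrACA.
  - move=> x n n'; rewrite /phi !big_cons !big_nil !addr0 /= -mulrDr subrr; exact: Q0.
  - move=> r x n; rewrite /phi !big_seq1 /= mulrA -mulrBl; apply: QT.
    have [cA [s sA es]] := hc x.
    rewrite [c x * _]mulrC; apply: (cQ _ _ (val r * s)); rewrite ?rpredM //; try exact: valP.
    by rewrite /= es mulrDr !mulrA.
have := key _ _ (flat_ideal2 fl e); rewrite /phi !big_seq1 /= mulr1.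
set ca := c _; set cb := c _ => h.
have ha : Q (ca - 1) by apply: (cQ _ _ 0); rewrite ?rpred0 ?rpred1 //= mul1r mul0r addr0.
have hb : Q (cb - 0) by apply: (cQ _ _ 1); rewrite ?rpred0 ?rpred1 //= mul1r mul0r add0r.
rewrite subr0 in hb; have := QD _ _ h (mul_set_mem hb yT).
rewrite subrK => hca; have N1 : -1 \in T by rewrite rpredN rpred1.
have := QD _ _ hca (QZ _ _ N1 (sub_ext T ha)).
by rewrite mulN1r opprB addrCA subrr addr0.
Qed.

(** * Independent families *)

Lemma exists_prime_idealr (R : comNzRingType) (I : {pred R}) :
  idealr_closed I -> prime_idealr_closed I ->
  exists P : prime_idealr R, P =i I.
Proof.
move=> cI pI.
pose P := HB.pack_for (prime_idealr R) (I : R -> bool)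
  (isIdealr.Build R (I : R -> bool) cI)
  (isPrimeIdealrClosed.Build R (I : R -> bool) pI).
by exists P => x.
Qed.

(* A prime ideal of the subring [T S] which is maximal among those containing
   a nonunit [b] of [A] contracts to a prime of [A] surviving in [T] and [S]. *)
Lemma independent_mul (K : fieldType) (A T S : subringClosed K)
    (Theta : set (subringClosed K)) :
  is_quotient_field A -> independent_family A Theta ->
  {subset A <= T} -> {subset A <= S} ->
  Theta T -> Theta S -> T <> S -> mul_set [set` T] [set` S] = setT.
Proof.
move=> qA ind AT AS hT hS nTS; set C := mul_set _ _.
have TC : [set` T] `<=` C by exact: sub_ext.
have SC : [set` S] `<=` C by rewrite /C mul_setC; exact: sub_ext.
have CM x y : C x -> C y -> C (x * y).
  move=> Cx Cy; have : mul_set C C (x * y) by exact: mul_set_mem.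
  rewrite /C -mul_setA (mul_setC [set` S]) -(mul_setA [set` T]).
  rewrite (ext_subring (fun _ h => h)) mul_setA.
  by rewrite (ext_subring (fun _ h => h)).
have CD x y : C x -> C y -> C (x + y) by exact: mul_setD.
have C0 : C 0 by exact: mul_set0.
have C1 : C 1 by apply: TC; exact: rpred1.
apply/seteqP; split=> // z _; apply: contrapT => nz.
have [a [b [aA bA b0 ez]]] := qA z.
have nb : ~ C b^-1 by move=> h; apply: nz; rewrite ez; apply: CM => //; exact/TC/AT.
pose good (X : set K) := [/\ X b, ~ X 1, forall x y, X x -> X y -> X (x + y)
  & forall c x, C c -> X x -> X (c * x)].
have gb : good [set b * c | c in C].
  split.
  - by exists 1; rewrite ?mulr1.
  - move=> [c Cc e]; apply: nb; suff -> : b^-1 = c by [].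
    by rewrite -[RHS](mulKf b0) e mulr1.
  - by move=> _ _ [c Cc <-] [d Cd <-]; exists (c + d); rewrite ?mulrDr //; exact: CD.
  - by move=> c _ Cc [d Cd <-]; exists (c * d); rewrite 1?mulrCA //; exact: CM.
have [F FP Ftot|M [[M0|[Mb M1 MD MZ]] maxM]] :=
    @Zorn_bigcup _ [set X | X = set0 \/ good X].
- have [[X FX Xb]|nF] := pselect (exists2 X, F X & X b); last first.
    left; apply/seteqP; split=> // x [X FX Xx].
    by have [X0|[Xb _ _ _]] := FP X FX; [rewrite X0 in Xx|case: nF; exists X].
  right; split.
  + by exists X.
  + by move=> [Y FY Y1]; have [Y0|[]] := FP Y FY; [rewrite Y0 in Y1|].
  + move=> x y [Y FY Yx] [Z FZ Zy].
    have [YZ|ZY] := Ftot Y Z FY FZ; [exists Z|exists Y] => //.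
      have [Z0|[_ _ ZD _]] := FP Z FZ; [by rewrite Z0 in Zy|exact/ZD/Zy/YZ].
    have [Y0|[_ _ YD _]] := FP Y FY; [by rewrite Y0 in Yx|exact/YD/ZY].
  + move=> c x Cc [Y FY Yx]; exists Y => //.
    by have [Y0|[_ _ _ YZ]] := FP Y FY; [rewrite Y0 in Yx|exact: YZ].
- apply: (maxM _ _ (or_intror gb)); rewrite M0; split=> //.
  by move=> /(_ b); apply; have [] := gb.
have M_0 : M 0 by rewrite -(mul0r b); exact: MZ.
have MN x : M x -> M (- x).
  by move=> Mx; rewrite -mulN1r; apply: MZ => //; apply/TC; rewrite /= rpredN rpred1.
(* A maximal [M] is prime: if [M + u C] contains 1, multiplying by [v] puts [v] in [M]; otherwise it
   is a larger proper ideal. *)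
have Mprime u v : C u -> C v -> M (u * v) -> ~ M u -> M v.
  move=> Cu Cv Muv nMu.
  pose N := [set x | exists2 m, M m & exists2 c, C c & x = m + u * c].
  have MN' : M `<` N.
    split=> [m Mm|NM]; first by exists m => //; exists 0; rewrite // mulr0 addr0.
    by apply: nMu; apply: NM; exists 0 => //; exists 1; rewrite // mulr1 add0r.
  have [[m Mm [c Cc e1]]|nN1] := pselect (N 1).
    rewrite -[v]mulr1 e1 mulrDr; apply: MD; first exact: MZ.
    by rewrite mulrCA mulrA mulrC; apply: MZ.
  case: (maxM N) => //; right; split=> //; first exact: MN'.1.
    move=> _ _ [m Mm [c Cc ->]] [m' Mm' [c' Cc' ->]].
    by exists (m + m'); [exact: MD|exists (c + c'); [exact: CD|rewrite mulrDr addrACA]].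
  move=> d _ Cd [m Mm [c Cc ->]]; exists (d * m); first exact: MZ.
  by exists (d * c); [exact: CM|rewrite mulrDr mulrCA].
have AC x : x \in A -> C x by move=> /AT/TC.
pose I : {pred subring_type A} := [pred x | `[< M (val x) >]].
have [|u v /asboolP|P eP] := @exists_prime_idealr _ I.
- split; first by apply/asboolP.
    by apply/asboolPn.
  move=> c x y /asboolP Mx /asboolP My; apply/asboolP; apply: MD => //.
  by apply: MZ => //; exact/AC/valP.
- move=> Muv; apply/orP.
  have [Mu|nMu] := pselect (M (val u)); [left|right]; apply/asboolP => //.
  by apply: Mprime Muv nMu; apply/AC/valP.
have ext_proper (B : subringClosed K) : [set` B] `<=` C -> extension P B <> [set` B].
  move=> BC e; apply: M1; have : extension P B 1 by rewrite e; exact: rpred1.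
  apply: mul_set_least => // _ y [p /= + <-] /BC Cy.
  by rewrite eP => /asboolP Mp; rewrite mulrC; exact: MZ.
apply: (ind T S hT hS nTS); exists P; split; try exact: ext_proper.
exists (Sub b bA); first by rewrite eP; apply/asboolP.
by apply/eqP => /(congr1 val) /= /eqP; apply/negP.
Qed.

(** * Jaffard overrings *)

HB.instance Definition _ (K : fieldType) := gen_eqMixin (subringClosed K).
HB.instance Definition _ (K : fieldType) := gen_choiceMixin (subringClosed K).

Section Splitting.
Variable K : fieldType.
Implicit Types (A B T S : subringClosed K) (I J L : set K).
Implicit Types (N : set (subringClosed K)).

(** [ys] consists of the coefficients from [T] in one expression of [x]; an element that clears them
    all moves [x] into [I]. *)
Lemma mul_set_den A T I x : submodule A I -> ext I T x ->
  exists2 ys : seq K, {subset ys <= T} & forall e, den A ys e -> I (e * x).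
Proof.
move=> [I0 ID IZ] [s hs ->]; exists [seq p.2 | p <- s].
  by move=> y /mapP[p /hs[_ ?] ->].
move=> e [eA he]; rewrite big_distrr /= big_seq; elim/big_ind: _ => // p ps.
rewrite mulrCA mulrC; apply: IZ; last by have [] := hs p ps.
exact/he/map_f.
Qed.

(** Writing 1 as a combination of elements of [L] with coefficients in [T] writes [u] as a
    combination of elements [e * u] of [M]. *)
Lemma ext1_mem T L M u : submodule T M -> ext L T 1 ->
  (forall e, L e -> M (e * u)) -> M u.
Proof.
move=> [M0 MD MZ] L1 hM; rewrite -[u]mul1r; move: {L1} 1 L1.
apply: (@mul_set_least _ _ _ [set x | M (x * u)]) => /=; first by rewrite mul0r.
  by move=> x y ? ?; rewrite mulrDl; exact: MD.
by move=> x t Lx tT; rewrite mulrAC mulrC; apply: MZ => //; exact: hM.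
Qed.

Lemma quotient_subring A B : {subset A <= B} -> is_quotient_field A -> is_quotient_field B.
Proof.
move=> AB qA x; have [a [b [? ? ? ?]]] := qA x.
by exists a, b; split=> //; exact: AB.
Qed.

Lemma exists_denominator A x : is_quotient_field A ->
  exists d, [/\ d \in A, d != 0 & d * x \in A].
Proof.
move=> qA; have [a [b [aA bA b0 ->]]] := qA x.
by exists b; rewrite mulrCA mulfV // mulr1.
Qed.

(* Together with [T `&` \bigcap S = A] this says that [K / A] is the direct sum
   of [T / A] and [(\bigcap S) / A], with [S] ranging over [N] minus [T]. *)
Definition splits N T := forall z : K, exists t u,
  [/\ t \in T, forall S, N S -> S <> T -> u \in S & z = t + u].

Lemma complete_subring A N x : complete_family A N ->
  (forall T, N T -> {subset A <= T}) -> (forall T, N T -> x \in T) -> x \in A.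
Proof.
move=> cN AN xN; have : [set` A] x; last by [].
rewrite (cN _ (subring_fractional A)) => T NT.
by rewrite ext_subring; [exact: xN|exact: AN].
Qed.

(** Let [La] be a Jaffard family containing [T]. For [z = 1 / d], let [H] be the ideal of elements
    carrying [1 / d] into the other members of [La], and [J] that of elements carrying it into [T].
    Completeness of [La] gives [1 = h + j], whence [1 / d = j / d + h / d]. *)
Lemma Jaffard_splits A N T : is_quotient_field A -> Jaffard_overring A T ->
  (forall S, N S -> S <> T -> [/\ {subset A <= S}, clears A S
     & mul_set [set` T] [set` S] = setT]) ->
  splits N T.
Proof.
move=> qA [La [Lfl Lc Li Ll _] LT] hN.
have LA R : La R -> {subset A <= R} by move=> /Lfl[].
have Lcl R : La R -> clears A R by move=> /Lfl; exact: flat_clears.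
have LK R : La R -> R <> T -> mul_set [set` T] [set` R] = setT.
  by move=> LR /nesym nRT; exact: (independent_mul qA Li (LA _ LT) (LA _ LR)).
have AT := LA _ LT.
suff main d : d \in A -> d != 0 -> exists t u,
    [/\ t \in T, forall S, N S -> S <> T -> u \in S & d^-1 = t + u].
  move=> z; have [a [b [aA bA b0 ->]]] := qA z.
  have [t [u [tT uS ->]]] := main b bA b0; exists (a * t), (a * u).
  rewrite mulrDr; split=> //; first by rewrite rpredM // AT.
  by move=> S NS nST; have [AS _ _] := hN S NS nST; rewrite rpredM ?uS ?AS.
move=> dA d0.
pose H := [set h | h \in A /\ forall R, La R -> R <> T -> h / d \in R].
pose J := [set j | j \in A /\ j / d \in T].
have H1 : ext H T 1.
  (* By local finiteness [d] is a nonunit in finitely many members only, listed in [F]. For each of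
     them other than [T], [T R = K] expresses [1 / d] with finitely many coefficients in [T];
     clearing all of these gives elements of [H]. *)
  have [F eF] := (iffLR (finite_seqP _)) (Ll d dA d0).
  have [ys ysT hys] : exists2 ys : seq K, {subset ys <= T} &
      forall R, R \in F -> La R -> R <> T -> forall e, den A ys e -> e / d \in R.
    elim: (F) => [|R G [ys ysT hys]]; first by exists [::].
    have [[LR nRT]|nR] := pselect (La R /\ R <> T); last first.
      exists ys => // R'; rewrite inE => /orP[/eqP-> ? ?|]; last exact: hys.
      by case: nR.
    have : ext [set` R] T d^-1 by rewrite mul_setC LK.
    move=> /(mul_set_den (submodule_subring (LA _ LR)))[zs zsT hzs].
    exists (zs ++ ys); first by move=> y; rewrite mem_cat => /orP[/zsT|/ysT].
    move=> R'; rewrite inE => /orP[/eqP-> _ _|R'G LR' nR'] e [eA he].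
      by apply: hzs; split=> // y ys'; rewrite he // mem_cat ys'.
    by apply: hys => //; split=> // y ys'; rewrite he // mem_cat ys' orbT.
  have := clears_seq (Lcl _ LT) ysT; apply: mul_setS => // e de.
  have [eA _] := de; split=> // R LR nRT.
  have [RF|nRF] := boolP (R \in F); first exact: hys.
  rewrite rpredM ?(LA _ LR _ eA) //; have : ~ [set` F] R by exact/negP.
  rewrite -eF => nR; have : [set` R] 1 by exact: rpred1.
  rewrite -(contrapT (fun h => nR (conj LR h))) => -[t tR e1].
  suff -> : d^-1 = t by exact: tR.
  by rewrite -[RHS](mulKf d0) e1 mulr1.
have J1 R : La R -> R <> T -> ext J R 1.
  move=> LR nRT; have : ext [set` T] R d^-1 by rewrite LK.
  move=> /(mul_set_den (submodule_subring AT))[zs zsR hzs].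
  have := clears_seq (Lcl _ LR) zsR; apply: mul_setS => // e de.
  by have [eA _] := de; split=> //; exact: hzs.
pose HJ := [set x | exists2 h, H h & exists2 j, J j & x = h + j].
have fHJ : fractional_ideal A HJ.
  split; last first.
    exists 1; split; rewrite ?rpred1 ?oner_neq0 // => _ [h [hA _] [j [jA _] ->]].
    by rewrite mul1r rpredD.
  split.
  - exists 0; last (exists 0; last by rewrite addr0).
      by split=> [|R _ _]; rewrite ?mul0r rpred0.
    by split; rewrite ?mul0r rpred0.
  - move=> _ _ [h [hA hR] [j [jA jT] ->]] [h' [hA' hR'] [j' [jA' jT'] ->]].
    exists (h + h'); last (exists (j + j'); last by rewrite addrACA).
      by split=> [|R LR nR]; rewrite ?mulrDl rpredD ?hR ?hR'.
    by split; rewrite ?mulrDl rpredD.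
  - move=> a _ aA [h [hA hR] [j [jA jT] ->]].
    exists (a * h); last (exists (a * j); last by rewrite mulrDr).
      by split=> [|R LR nR]; rewrite -?mulrA rpredM ?hR // (LA _ LR).
    by split; rewrite -?mulrA rpredM // AT.
have HHJ : H `<=` HJ.
  move=> h Hh; exists h => //; exists 0; last by rewrite addr0.
  by split; rewrite ?mul0r rpred0.
have JHJ : J `<=` HJ.
  move=> j Jj; exists 0; last by exists j; rewrite ?add0r.
  by split=> [|R _ _]; rewrite ?mul0r rpred0.
have [h [hA hR] [j [jA jT] e1]] : HJ 1.
  rewrite (Lc _ fHJ) => R LR; have [->|nRT] := pselect (R = T).
    exact: mul_setS H1.
  by apply: mul_setS (J1 R LR nRT).
exists (j / d), (h / d); split=> //; last by rewrite addrC -mulrDl -e1 mul1r.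
(* [S] need not belong to [La]. As [T S = K], the elements [e] of [A] that carry [1 / d] into [T]
   generate the unit ideal of [S]; for these, [e * h / d] lies in all members of [La], hence in
   [A]. *)
move=> S NS nST; have [AS clS SK] := hN S NS nST.
have : ext [set` T] S d^-1 by rewrite SK.
move=> /(mul_set_den (submodule_subring AT))[zs zsS hzs].
apply: (ext1_mem (submodule_subring (fun _ x => x)) (clears_seq clS zsS)) => e de.
apply: AS; apply: (complete_subring Lc LA) => R LR; have [eA _] := de.
have [->|nRT] := pselect (R = T); last by rewrite rpredM ?hR // (LA _ LR).
by rewrite mulrCA rpredM // ?(AT _ hA) //; exact: hzs.
Qed.

End Splitting.

(** * Modifying an ideal at one overring *)

Section Modification.
Variables (K : fieldType) (A : subringClosed K) (N : set (subringClosed K)).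
Implicit Types (T S : subringClosed K) (I J : set K).
Hypothesis qA : is_quotient_field A.
Hypothesis NA : forall S, N S -> {subset A <= S}.
Hypothesis Ncl : forall S, N S -> clears A S.
(* Completeness may fail at the zero ideal, namely when [N] is empty. *)
Hypothesis Nc : forall I, fractional_ideal A I -> nonzero I ->
  forall x, (forall S, N S -> ext I S x) -> I x.

Lemma nonzero_subring (T : subringClosed K) : nonzero [set` T].
Proof. by exists 1; [exact: rpred1|exact: oner_neq0]. Qed.

Lemma nonzero_mull I J : nonzero (mul_set I J) -> nonzero I.
Proof.
move=> [z zIJ z0]; apply: contrapT => nI; move/eqP: z0; apply.
move: zIJ; apply: (@mul_set_least _ _ _ [set x | x = 0]) => //= [x y -> ->|x y Ix _].
  by rewrite addr0.
by have [->|x0] := eqVneq x 0; [rewrite mul0r|case: nI; exists x].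
Qed.

(** Any nonzero [e] in [J] serves: if [a / e = p / q] then [q * a = p * e]. *)
Lemma absorb J a : submodule A J -> nonzero J ->
  exists d, [/\ d \in A, d != 0 & J (d * a)].
Proof.
move=> [_ _ JZ] [e Je e0]; have [p [q [pA qA' q0 epq]]] := qA (a / e).
exists q; split=> //; suff -> : q * a = p * e by exact: JZ.
by apply: (mulIf (invr_neq0 e0)); rewrite mulfK // -mulrA epq mulrCA mulfV ?mulr1.
Qed.

Lemma inter_mem x : (forall S, N S -> x \in S) -> x \in A.
Proof.
move=> h; apply: (Nc (subring_fractional A) (nonzero_subring A)) => S NS.
by rewrite ext_subring; [exact: h|exact: NA].
Qed.

Lemma local_invertible I I' : fractional_ideal A I -> fractional_ideal A I' ->
  nonzero I -> nonzero I' ->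
  (forall S, N S -> mul_set (ext I S) (ext I' S) = [set` S]) ->
  mul_set I I' = [set` A].
Proof.
move=> fI fI' nI nI' h.
have fM := mul_set_fractional fI fI'; have nM := nonzero_mul nI nI'.
apply/seteqP; split=> x.
  by move=> Mx; apply: inter_mem => S NS; have := sub_ext S Mx; rewrite ext_mul h.
by move=> xA; apply: Nc => // S NS; rewrite ext_mul h //; exact: NA.
Qed.

(** [J1] is the intersection of [B] with the extensions of [J] to the other members. It is large
    enough because of the splitting [1 / d = t + u]: if [h * t] is in [A], then [h / d] lies in all
    the other members, and if [j * u] is in [A], then [j / d] lies in [T]. *)
Lemma modify T B J : N T -> splits N T -> fractional_ideal T B -> nonzero B ->
  fractional_ideal A J -> nonzero J ->
  exists J1, [/\ fractional_ideal A J1, ext J1 T = B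
    & forall S, N S -> S <> T -> ext J1 S = ext J S].
Proof.
move=> NT sp [sB [dB [dBT dB0 hdB]]] nB [sJ [dJ [dJA dJ0 hdJ]]] nJ.
have sB' := submodule_sub (NA NT) sB.
have [B0 BD BZ] := sB; have [J0 JD JZ] := sJ.
pose J1 := [set x | B x /\ forall S, N S -> S <> T -> ext J S x].
exists J1; split; [split|apply/seteqP; split|].
- split.
  + by split=> // S _ _; exact: mul_set0.
  + by move=> x y [Bx hx] [By hy]; split=> [|S NS nST];
      [exact: BD|apply: mul_setD; [exact: hx|exact: hy]].
  + move=> a x aA [Bx hx]; split=> [|S NS nST]; first exact/BZ/Bx/NA/aA.
    by apply: extZ; [exact: NA|exact: hx].
(* [dB] is only known to lie in [T]; its numerator [p] lies in [A] and is still a denominator for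
   [B], being [q * dB]. *)
- have [p [q [pA qA' q0 epq]]] := qA dB.
  have ep : p = q * dB by rewrite epq mulrCA mulfV ?mulr1.
  exists (p * dJ); split; first exact: rpredM.
    by rewrite ep !mulf_neq0.
  move=> x [Bx hx]; apply: inter_mem => S NS.
  have [->|nST] := pselect (S = T).
    suff -> : p * dJ * x = q * dJ * (dB * x).
      by apply: rpredM; [apply: (NA NT); exact: rpredM|exact: hdB].
    by rewrite ep -!mulrA (mulrCA dB).
  rewrite -mulrA; apply: rpredM; first exact: (NA NS).
  move: (hx S NS nST); move: x {Bx hx}.
  apply: (@mul_set_least _ _ _ [set x | dJ * x \in S]) => /=.
  + by rewrite mulr0 rpred0.
  + by move=> x y ? ?; rewrite mulrDr rpredD.
  + by move=> x y Jx yS; rewrite mulrA rpredM // (NA NS) // hdJ.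
- by apply: ext_least => // x [].
- move=> a Ba; have [d [dA d0 Jda]] := absorb a sJ nJ.
  have [t [u [tT uS etu]]] := sp d^-1.
  apply: (ext1_mem (ext_submodule _ _) (Ncl NT tT)) => h [hA ht].
  apply: sub_ext; split=> [|S NS nST]; first exact/BZ/Ba/(NA NT).
  suff -> : h * a = (h * t + h * u) * (d * a).
    apply: extZ; last exact: sub_ext.
    apply: rpredD; first by apply: (NA NS); apply: ht; exact: mem_head.
    by apply: rpredM; [exact: (NA NS)|exact: uS].
  by rewrite -mulrDr -etu mulrA divfK.
- move=> S NS nST; apply/seteqP; split.
    by apply: ext_least; [exact: ext_submodule|move=> x [_ hx]; exact: hx].
  apply: ext_least; first exact: ext_submodule.
  move=> y Jy; have [d [dA d0 Bdy]] := absorb y sB' nB.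
  have [t [u [tT uS etu]]] := sp d^-1.
  apply: (ext1_mem (ext_submodule _ _) (Ncl NS (uS S NS nST))) => j [jA hj].
  apply: sub_ext; split=> [|S' NS' _]; last exact/sub_ext/JZ.
  suff -> : j * y = (j * t + j * u) * (d * y).
    apply: BZ => //; apply: rpredD; first by apply: rpredM => //; exact: (NA NT).
    by apply: (NA NT); apply: hj; exact: mem_head.
  by rewrite -mulrDr -etu mulrA divfK.
Qed.

Lemma modify_seq (l : seq (subringClosed K)) J :
  (forall T, T \in l -> N T /\ splits N T) ->
  fractional_ideal A J -> nonzero J ->
  exists J1, [/\ fractional_ideal A J1, nonzero J1
    & forall S, N S -> ext J1 S = if S \in l then [set` S] else ext J S].
Proof.
move=> hl fJ nJ; elim: l hl => [|T l IHl] hl; first by exists J.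
have [|J1 [fJ1 nJ1 hJ1]] := IHl; first by move=> S Sl; apply: hl; rewrite inE Sl orbT.
have [NT sT] := hl T (mem_head _ _).
have [J2 [fJ2 hT hS]] :=
  modify NT sT (subring_fractional T) (nonzero_subring T) fJ1 nJ1.
exists J2; split=> //.
  by apply: (@nonzero_mull _ [set` T]); rewrite hT; exact: nonzero_subring.
move=> S NS; rewrite inE; have [->|/eqP nST] := eqVneq S T; first by rewrite hT.
by rewrite hS // hJ1.
Qed.

(** [J] and [J'] are inverse to each other at the members outside [l]; making both trivial on [l]
    makes them inverse at every member, hence inverse ideals of [A]. *)
Lemma invertible_modify_seq (l : seq (subringClosed K)) J J' :
  (forall T, T \in l -> N T /\ splits N T) ->
  fractional_ideal A J -> nonzero J -> fractional_ideal A J' -> nonzero J' ->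
  (forall S, N S -> S \notin l -> mul_set (ext J S) (ext J' S) = [set` S]) ->
  exists I : InvIdeals A, forall S, N S -> S \notin l -> ext I S = ext J S.
Proof.
move=> hl fJ nJ fJ' nJ' h.
have [J1 [fJ1 nJ1 hJ1]] := modify_seq hl fJ nJ.
have [J1' [fJ1' nJ1' hJ1']] := modify_seq hl fJ' nJ'.
have iJ1 : invertible A J1.
  split=> //; exists J1' => //; apply: local_invertible => // S NS.
  rewrite hJ1 // hJ1' //; case: ifPn => [_|/h->//].
  by rewrite ext_subring.
by exists (MkInv iJ1) => S NS nS /=; rewrite hJ1 // (negPf nS).
Qed.

(** The unit ideal is modified at [T] to [B] and, separately, to the inverse of [B]; the results are
    inverse to each other at every member. *)
Lemma invertible_modify T (B : InvIdeals T) : N T -> splits N T ->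
  exists I : InvIdeals A, ext I T = B /\
    forall S, N S -> S <> T -> ext I S = [set` S].
Proof.
move=> NT sT; have [fB [B' fB' eB]] := InvP B.
have iB' : invertible T B' by split=> //; exists B => //; rewrite mul_setC.
have nA := nonzero_subring A; have fA := subring_fractional A.
have [I [fI IT IS]] := modify NT sT fB (invertible_nonzero (InvP B)) fA nA.
have [I' [fI' IT' IS']] := modify NT sT fB' (invertible_nonzero iB') fA nA.
have nI : nonzero I.
  by apply: (@nonzero_mull _ [set` T]); rewrite IT; exact: invertible_nonzero (InvP B).
have nI' : nonzero I'.
  by apply: (@nonzero_mull _ [set` T]); rewrite IT'; exact: invertible_nonzero iB'.
have iI : invertible A I.
  split=> //; exists I' => //; apply: local_invertible => // S NS.
  have [->|nST] := pselect (S = T); first by rewrite IT IT'.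
  by rewrite IS // IS' // !ext_subring //; exact: NA.
exists (MkInv iI); split=> // S NS nST /=.
by rewrite IS // ext_subring //; exact: NA.
Qed.

End Modification.

(** * The derived sequence *)

Section WellOrderTheory.
Variables (W : Type) (le : rel W).
Hypothesis wo : wochoice.well_order le.
Local Notation wlt := (wlt le).

Lemma wo_min (P : W -> Prop) : (exists x, P x) ->
  exists2 m, P m & forall x, P x -> le m x.
Proof.
move=> [x Px].
have /wo[m [[/asboolP Pm hm] _]] : wochoice.nonempty [pred x | `[< P x >]].
  by exists x; exact/asboolP.
by exists m => // y Py; apply: hm; exact/asboolP.
Qed.

Lemma wo_refl x : le x x.
Proof. by have [|m -> h] := @wo_min (eq^~ x); [exists x|exact: h]. Qed.

Lemma wo_total x y : le x y || le y x.
Proof.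
have [|m [->|->] h] := @wo_min (fun z => z = x \/ z = y).
- by exists x; left.
- by rewrite h //; right.
- by rewrite orbC h //; left.
Qed.

Lemma wo_anti x y : le x y -> le y x -> x = y.
Proof.
move=> xy yx; pose X := [pred z | `[< z = x \/ z = y >]].
have [|m [_ mu]] := @wo X; first by exists x; apply/asboolP; left.
rewrite -(mu x); last first.
  by split=> [|z /asboolP[]->] //; [apply/asboolP; left|exact: wo_refl].
apply: mu; split=> [|z /asboolP[]->] //; last exact: wo_refl.
by apply/asboolP; right.
Qed.

Lemma wo_trans x y z : le x y -> le y z -> le x z.
Proof.
move=> xy yz; have [|m hm h] := @wo_min (fun w => [\/ w = x, w = y | w = z]).
  by exists x; constructor 1.
have [mx my mz] : [/\ le m x, le m y & le m z].
  by split; apply: h; [constructor 1|constructor 2|constructor 3].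
case: hm => e; rewrite e in mx my mz => //.
  by rewrite (wo_anti xy mx).
by rewrite -(wo_anti yz my).
Qed.

Lemma wltW x y : wlt x y -> le x y.
Proof. by rewrite /Defs.wlt; case/orP: (wo_total x y) => ->. Qed.

Lemma wlt_le_trans x y z : wlt x y -> le y z -> wlt x z.
Proof. by move=> xy yz; apply/negP => zx; move/negP: xy; apply; exact: wo_trans zx. Qed.

Lemma exists_zero (a : W) : exists2 m, is_zero le m & le m a.
Proof.
have [|m _ h] := @wo_min (fun=> True); first by exists a.
by exists m; [move=> b; rewrite negbK; exact: h|exact: h].
Qed.

(** With [P x r] read as: [x] has rank [r], this selects an entry of largest rank. *)
Lemma seq_max (T : eqType) (s : seq T) (P : T -> W -> Prop) (b0 : W) :
  (forall x, x \in s -> exists2 r, P x r & le r b0) ->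
  s = [::] \/ exists x b, [/\ x \in s, P x b
    & forall y, y \in s -> exists2 r, P y r & le r b].
Proof.
elim: s => [|x s IHs] h; [by left|right].
have [r Pr rb0] := h x (mem_head _ _).
have [|e|[y [b [ys Pb hb]]]] := IHs; first by move=> z zs; apply: h; rewrite inE zs orbT.
  exists x, r; split; rewrite ?mem_head // => z; rewrite e inE => /eqP->.
  by exists r => //; exact: wo_refl.
have [rb|br] := orP (wo_total r b).
  exists y, b; split; rewrite ?inE ?ys ?orbT // => z /orP[/eqP->|/hb//].
  by exists r.
exists x, r; split; rewrite ?mem_head // => z; rewrite inE => /orP[/eqP->|/hb[r' ? r'b]].
  by exists r => //; exact: wo_refl.
by exists r' => //; exact: wo_trans br.
Qed.

End WellOrderTheory.

Section DerivedSequenceTheory.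
Variables (K : fieldType) (D : subringClosed K) (Theta : set (subringClosed K)).
Variables (W : Type) (le : rel W) (wo : wochoice.well_order le).
Hypothesis hK : is_quotient_field D.
Hypothesis hTheta : pre_Jaffard_family D Theta.
Implicit Types (a b c r : W) (T S : subringClosed K) (I J : set K).

Local Notation wlt := (wlt le).
Local Notation N := (derived D Theta wo).
Local Notation R := (derived_ring D Theta wo).

Lemma derived_anti a b : le a b -> N b `<=` N a.
Proof.
elim/(well_founded_ind (wlt_wf wo)): b => b IHb ab.
have [ba|ba] := boolP (le b a); first by rewrite (wo_anti wo ab ba).
have [[c cb]|ns] := pselect (exists c, is_succ le c b).
  rewrite (derived_succ D Theta wo cb) => T [NcT _]; apply: IHb NcT; first exact: cb.1.
  exact: cb.2 _ ba.
rewrite derived_limit; first by move=> T; exact.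
split=> [/(_ a)|c cb]; last by apply: ns; exists c.
by rewrite /Defs.wlt negbK (negPf ba).
Qed.

Lemma derived_sub a : N a `<=` Theta.
Proof.
have [m m0 /derived_anti h] := exists_zero wo a.
by rewrite (derived_zero D Theta wo m0) in h.
Qed.

(* [T] belongs to the sequence exactly up to the index [r]. *)
Definition rank r T := [/\ N r T, Jaffard_overring (R r) T
  & forall s, wlt r s -> ~ N s T].

(** The least index [s] with [T] outside [N s] is a successor: it is not zero, as [N] starts at
    [Theta], and not a limit, as [N] is an intersection there. Its predecessor is the rank. *)
Lemma exists_rank a T : Theta T -> ~ N a T -> exists2 r, rank r T & wlt r a.
Proof.
move=> hT nT; have [|s nsT hs] := @wo_min _ _ wo (fun s => ~ N s T); first by exists a.
have [[c cs]|ns] := pselect (exists c, is_succ le c s).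
  have NcT : N c T.
    by apply: contrapT => /hs sc; move/negP: cs.1; apply.
  exists c; last exact: (wlt_le_trans wo cs.1 (hs a nT)).
  split=> //.
    apply: contrapT => nJ; apply: nsT; rewrite (derived_succ D Theta wo cs); split=> //.
  move=> t ct NtT; apply: nsT; apply: derived_anti NtT.
  by have [//|nst] := boolP (le s t); have := cs.2 t nst; rewrite (negPf ct).
exfalso; apply: nsT; have [s0|s0] := pselect (is_zero le s).
  by rewrite (derived_zero D Theta wo s0).
rewrite derived_limit; last by split=> // c cs; apply: ns; exists c.
by move=> c cs; apply: contrapT => /hs sc; move/negP: cs; apply.
Qed.

Lemma rank_le r a T : rank r T -> N a T -> le a r.
Proof.
move=> [_ _ h] NaT; case/orP: (wo_total wo a r) => // ra.
by apply: contrapT => /negP ar; exact: (h a ar).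
Qed.

Lemma Theta_sub T : Theta T -> {subset D <= T}.
Proof. by case: hTheta => fl _ _ _ _ /fl[]. Qed.

Lemma Theta_clears T : Theta T -> clears D T.
Proof. by case: hTheta => fl _ _ _ _ /fl; exact: flat_clears. Qed.

Lemma Theta_mul T S : Theta T -> Theta S -> T <> S ->
  mul_set [set` T] [set` S] = setT.
Proof.
case: hTheta => _ _ ind _ _ hT hS.
exact: (independent_mul hK ind (Theta_sub hT) (Theta_sub hS) hT hS).
Qed.

(** At index zero the ring is [D] by definition, and completeness of [Theta] identifies it with the
    intersection. *)
Lemma derived_ringP a x : x \in R a <-> (forall T, N a T -> x \in T).
Proof.
rewrite /derived_ring /ring_of; case: asboolP => a0; last first.
  by split=> [/asboolP//|h]; exact/asboolP.
rewrite (derived_zero D Theta wo a0); split=> [xD T hT|]; first exact: Theta_sub xD.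
by case: hTheta => _ c _ _ _; exact: (complete_subring c Theta_sub).
Qed.

Lemma derived_ring_sub a T : N a T -> {subset R a <= T}.
Proof. by move=> NaT x /derived_ringP; apply. Qed.

Lemma sub_derived_ring a : {subset D <= R a}.
Proof. by move=> x xD; apply/derived_ringP => T /derived_sub/Theta_sub; exact. Qed.

Lemma derived_ringS a b : le a b -> {subset R a <= R b}.
Proof.
by move=> ab x /derived_ringP h; apply/derived_ringP => T /(derived_anti ab); exact: h.
Qed.

Lemma derived_quotient a : is_quotient_field (R a).
Proof. exact: quotient_subring (@sub_derived_ring a) hK. Qed.

Lemma derived_clears a T : N a T -> clears (R a) T.
Proof.
move=> NaT; have /Theta_clears := derived_sub NaT; apply: clearsW.
  exact: sub_derived_ring.
exact: derived_ring_sub.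
Qed.

Lemma rank_splits r T : rank r T -> splits (N r) T.
Proof.
move=> [NrT JT _]; apply: (Jaffard_splits (derived_quotient r) JT) => S NrS nST.
split; [exact: derived_ring_sub|exact: derived_clears|].
by apply: Theta_mul (derived_sub NrT) (derived_sub NrS) _ => e; apply: nST.
Qed.

(** All members of [N a] are members of [N r] other than [T], where [r] is the rank of [T]; so the
    second summand of the splitting lies in [R a]. *)
Lemma splits_ring a T (z : K) : Theta T -> ~ N a T ->
  exists t u, [/\ t \in T, u \in R a & z = t + u].
Proof.
move=> hT nT; have [r rT ra] := exists_rank hT nT.
have [t [u [tT uS ->]]] := rank_splits rT z; exists t, u; split=> //.
apply/derived_ringP => S NaS; apply: uS; first exact: derived_anti (wltW wo ra) _ NaS.
by move=> e; apply: nT; rewrite -e.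
Qed.

(* It suffices to see that the ideal [B] of denominators in [D] of [x] modulo
   [I] extends to the unit ideal of every member of [Theta]. *)
Lemma derived_complete a I : fractional_ideal (R a) I -> nonzero I ->
  forall x, (forall T, N a T -> ext I T x) -> I x.
Proof.
move=> [sI _] nI x hx; have [I0 ID IZ] := sI.
pose B := [set b | b \in D /\ I (b * x)].
have fB : fractional_ideal D B.
  split; last by exists 1; split; rewrite ?rpred1 ?oner_neq0 // => b [bD _]; rewrite mul1r.
  split.
  - by split; rewrite ?rpred0 ?mul0r.
  - by move=> b c [bD Ib] [cD Ic]; split; [exact: rpredD|rewrite mulrDl; exact: ID].
  - move=> d b dD [bD Ib]; split; first exact: rpredM.
    by rewrite -mulrA; apply: IZ => //; exact: sub_derived_ring.
suff [] : B 1 by rewrite mul1r.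
case: hTheta => _ cT _ _ _; rewrite (cT _ fB) => T hT.
have [NaT|nT] := pselect (N a T).
  have sI' : submodule D I := submodule_sub (@sub_derived_ring a) sI.
  have [ys ysT hys] := mul_set_den sI' (hx T NaT).
  have := clears_seq (Theta_clears hT) ysT; apply: mul_setS => // e de.
  by split; [case: de|exact: hys].
(* At [T] outside [N a]: with [b * x] in [I] and [1 / b = t + u], every [e] clearing [t] makes
   [e * x = (e * t + e * u) * (b * x)] an [R a]-multiple of [b * x]. *)
have [b [bD b0 Ib]] := absorb hK x (submodule_sub (@sub_derived_ring a) sI) nI.
have [t [u [tT uR etu]]] := splits_ring b^-1 hT nT.
have := Theta_clears hT tT; apply: mul_setS => // e [eD he]; split=> //.
suff -> : e * x = (e * t + e * u) * (b * x).
  apply: IZ => //; apply: rpredD; first exact/sub_derived_ring/he/mem_head.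
  by apply: rpredM => //; exact: sub_derived_ring.
by rewrite -mulrDr -etu mulrA divfK.
Qed.

End DerivedSequenceTheory.

(** * Compactness and lifting of invertible ideals *)

HB.instance Definition _ (K : fieldType) (D : subringClosed K) :=
  isPointed.Build (Over D)
    (exist _ D (asboolT (fun (x : K) (xD : x \in D) => xD)) : Over D).

(** * Finite generation of invertible ideals *)

Section FinitelyGenerated.
Variables (K : fieldType) (A : subringClosed K).
Hypothesis qA : is_quotient_field A.

Lemma common_denominator (s : seq K) :
  exists d, [/\ d \in A, d != 0 & forall y, y \in s -> d * y \in A].
Proof.
elim: s => [|y s [d [dA d0 hd]]]; first by exists 1; rewrite rpred1 oner_neq0.
have [e [eA e0 he]] := exists_denominator y qA.
exists (d * e); split; rewrite ?rpredM ?mulf_neq0 // => z.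
rewrite inE => /orP[/eqP->|zs]; first by rewrite -mulrA rpredM.
by rewrite mulrAC rpredM ?hd.
Qed.

Lemma fractional_seq (s : seq K) : fractional_ideal A (ext [set` s] A).
Proof.
split; first exact: ext_submodule.
have [d [dA d0 hd]] := common_denominator s; exists d; split=> // x.
move: x; apply: (@mul_set_least _ _ _ [set x | d * x \in A]) => /=.
- by rewrite mulr0 rpred0.
- by move=> x y ? ?; rewrite mulrDr rpredD.
- by move=> x y xs yA; rewrite mulrA rpredM ?hd.
Qed.

Lemma fg_unit (T : subringClosed K) (s t : seq K) :
  mul_set [set` s] [set` t] 1 -> (forall x y, x \in s -> y \in t -> x * y \in T) ->
  mul_set (ext [set` s] T) (ext [set` t] T) = [set` T].
Proof.
move=> h1 hT; rewrite -ext_mul; apply: ext_eq1; last exact: sub_ext.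
apply: mul_set_least; [exact: rpred0|move=> x y; exact: rpredD|exact: hT].
Qed.

(** Write 1 as a sum of products of [x_i] in [J] and [y_i] in its inverse; then [y] is the sum of
    the [x_i * (y_i * y)]. Returning the [y_i] too turns invertibility into a condition on finitely
    many products. *)
Lemma invertible_fg (J : InvIdeals A) : exists s t : seq K,
  [/\ J = ext [set` s] A :> set K, mul_set [set` s] [set` t] 1
    & forall x y, x \in s -> y \in t -> x * y \in A].
Proof.
have [[[J0 JD JZ] _] [J' fJ' eJ]] := InvP J.
have : mul_set J J' 1 by rewrite eJ; exact: rpred1.
move=> [u hu e1]; pose s := [seq p.1 | p <- u]; pose t := [seq p.2 | p <- u].
have sJ : [set` s] `<=` Inv_set J by move=> x /mapP[p /hu[? _] ->].
have tJ : [set` t] `<=` J' by move=> x /mapP[p /hu[_ ?] ->].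
have hst x y : Inv_set J x -> J' y -> x * y \in A.
  by move=> Jx Jy; have := mul_set_mem Jx Jy; rewrite eJ.
exists s, t; split=> [||x y /sJ ? /tJ ?]; last exact: hst.
  apply/seteqP; split; last exact: ext_least.
  move=> y Jy; rewrite -[y]mul1r e1 big_distrl /= big_seq.
  elim/big_ind: _ => [|x z|p pu]; [exact: mul_set0|exact: mul_setD|].
  rewrite -mulrA; apply: mul_set_mem; first exact: map_f.
  by rewrite /= mulrC; apply: hst => //; apply: tJ; exact: map_f.
by exists u => // p pu; split; exact: map_f.
Qed.

End FinitelyGenerated.

Section Lifting.
Variables (K : fieldType) (D : subringClosed K) (Theta : set (subringClosed K)).
Variables (W : Type) (le : rel W) (wo : wochoice.well_order le).
Hypothesis hK : is_quotient_field D.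
Hypothesis hTheta : pre_Jaffard_family D Theta.
Implicit Types (a b c d r : W) (T S : subringClosed K) (I J : set K).

Local Notation wlt := (wlt le).
Local Notation N := (derived D Theta wo).
Local Notation R := (derived_ring D Theta wo).
Local Notation rank := (rank D Theta wo).

Lemma rank_inj r s T : rank r T -> rank s T -> r = s.
Proof.
move=> rT sT; have [NrT _ _] := rT; have [NsT _ _] := sT.
by apply: (wo_anti wo); [exact: (rank_le sT NrT)|exact: (rank_le rT NsT)].
Qed.

Lemma open_over (Y : seq K) : open [set S : Over D | {subset Y <= sval S}].
Proof.
elim: Y => [|y Y IHY].
  rewrite [X in open X](_ : _ = setT); first exact: openT.
  by apply/seteqP; split.
rewrite [X in open X](_ : _ =
    [set S : Over D | y \in sval S] `&` [set S : Over D | {subset Y <= sval S}]).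
  apply: openI => //; set U := [set S : Over D | y \in sval S].
  exists [set U]; last by rewrite bigcup_set1.
  move=> _ ->; exists [fset U]%fset; last by rewrite set_fset1 bigcap_set1.
  by move=> V /fset1P->; apply/mem_set; exists y.
apply/seteqP; split=> S /=.
  by move=> h; split=> [|z zY]; apply: h; rewrite inE ?eqxx ?zY ?orbT.
by move=> [h1 h2] z; rewrite inE => /orP[/eqP->|/h2].
Qed.

(* With [x Y] contained in [D] and [1 / x = t + u] the decomposition at a member
   [T] of rank [r], the open set defined by [t] contains [T], and its other
   members in [N r] contain [u], hence [1 / x], hence [Y]. *)
Lemma finite_exceptions a (Y : seq K) : (forall T, N a T -> {subset Y <= T}) ->
  exists F : seq (subringClosed K), (forall T, T \in F -> Theta T /\ ~ N a T) /\
    forall S, Theta S -> ~ {subset Y <= S} -> exists2 T, T \in F &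
      forall r, rank r T -> N r S -> S = T.
Proof.
move=> hY; have [x [xD x0 hx]] := common_denominator hK Y.
have YS S : Theta S -> x^-1 \in S -> {subset Y <= S}.
  move=> hS xS y yY; rewrite -(mulKf x0 y); apply: rpredM => //.
  exact/(Theta_sub hTheta hS)/hx.
have /choice[t ht] : forall T, exists t, Theta T -> ~ N a T -> t \in T /\
    forall r, rank r T -> forall S, N r S -> S <> T -> t \in S -> x^-1 \in S.
  move=> T; have [[hT nT]|n] := pselect (Theta T /\ ~ N a T); last first.
    by exists 0 => hT nT; case: n.
  have [r rT _] := exists_rank hT nT.
  have [t [u [tT uS e]]] := rank_splits hK hTheta rT x^-1; exists t => _ _.
  split=> // s sT S NsS nST tS; rewrite e rpredD // uS //.
  by rewrite (rank_inj rT sT).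
pose f T : set (Over D) :=
  if `[< N a T >] then [set S : Over D | {subset Y <= sval S}]
  else [set S : Over D | {subset [:: t T] <= sval S}].
have [_ _ _ + _] := hTheta; rewrite compact_cover => /(_ _ Theta f)[].
- by move=> T _; rewrite /f; case: ifP => _; exact: open_over.
- move=> T hT; exists (sval T) => //; rewrite /f; case: asboolP => [/hY//|nT] y.
  by rewrite inE => /eqP->; have [] := ht _ hT nT.
move=> G GT cG; exists [seq T <- G | ~~ `[< N a T >]]; split.
  move=> T; rewrite mem_filter => /andP[/asboolPn nT TG]; split=> //.
  by have := GT _ TG; rewrite inE.
move=> S hS nYS.
have [T TG] := cG (exist _ S (asboolT (Theta_sub hTheta hS))) hS.
rewrite /f; case: asboolP => [//|nT] /= tS.
have hT : Theta T by have := GT _ TG; rewrite inE.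
exists T; first by rewrite mem_filter asboolF.
move=> r rT NrS; apply: contrapT => nST; apply: nYS; apply: YS => //.
by have [_ h] := ht _ hT nT; apply: h rT _ NrS nST _; apply: tS; exact: mem_head.
Qed.

(** [d] is the largest rank of the finitely many exceptions [F]. A member of [N d] not containing
    [Y] equals some [T] in [F] of rank at most [d], and membership in [N d] forces this rank to be
    [d]. *)
Lemma descend a (Y : seq K) : (forall T, N a T -> {subset Y <= T}) ->
  (forall T, Theta T -> {subset Y <= T}) \/
  exists d (l : seq (subringClosed K)), [/\ wlt d a, forall T, T \in l -> rank d T
    & forall S, N d S -> S \notin l -> {subset Y <= S}].
Proof.
move=> /finite_exceptions[F [hF bad]].
have hr T : T \in F -> exists2 r, rank r T & le r a.
  move=> /hF[hT nT]; have [r ? ra] := exists_rank hT nT.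
  by exists r => //; exact: (wltW wo ra).
have [F0|[T0 [d [T0F dT0 hd]]]] := seq_max wo hr; [left|right].
  by move=> S hS; apply: contrapT => /(bad S hS)[T]; rewrite F0.
exists d, [seq T <- F | `[< rank d T >]]; split.
- have [hT0 nT0] := hF _ T0F; have [r rT0 ra] := exists_rank hT0 nT0.
  by rewrite (rank_inj dT0 rT0).
- by move=> T; rewrite mem_filter => /andP[/asboolP].
move=> S NdS; apply: contraNP => /(bad S (derived_sub NdS))[T TF hT].
have [r rT rd] := hd T TF; rewrite mem_filter.
have eST : S = T by apply: hT rT _; exact: derived_anti NdS.
rewrite eST TF andbT; apply/asboolP; rewrite eST in NdS.
by rewrite (wo_anti wo (rank_le rT NdS) rd).
Qed.

(** [J] is generated by [s], its invertibility is witnessed by [t], and the products [Y] lie in all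
    members of [N a]. If they lie in all of [Theta], [s] generates an invertible ideal of [D].
    Otherwise [s] and [t] generate ideals of [R d], with [d < a], inverse to each other outside [l];
    after modification on [l] the induction hypothesis applies. *)
Lemma Inv_lift a (J : InvIdeals (R a)) :
  exists I : InvIdeals D, ext I (R a) = J.
Proof.
elim/(well_founded_ind (wlt_wf wo)): a J => a IHa J.
have DR := @sub_derived_ring _ _ _ _ _ wo hTheta.
have RT b T : N b T -> {subset R b <= T} by exact: derived_ring_sub.
have [s [t [eJ e1 hst]]] := invertible_fg J.
have nz1 : nonzero (mul_set [set` s] [set` t]) by exists 1; rewrite ?oner_neq0.
have [ns nt] : nonzero [set` s] /\ nonzero [set` t].
  by split; apply: nonzero_mull; [exact: nz1|rewrite mul_setC; exact: nz1].
pose Y := [seq x * y | x <- s, y <- t].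
have YT T : {subset Y <= T} -> forall x y, x \in s -> y \in t -> x * y \in T.
  by move=> h x y xs yt; apply: h; exact: allpairs_f.
have /descend[hT|[d [l [da hl hY]]]] : forall T, N a T -> {subset Y <= T}.
- by move=> T NaT _ /allpairsP[p [ps pt ->]]; apply: (RT _ _ NaT); exact: hst.
- have sD : forall x y, x \in s -> y \in t -> x * y \in D.
    case: (hTheta) => _ c _ _ _ x y xs yt.
    apply: (complete_subring c (Theta_sub hTheta)) => T /hT/YT; exact.
  have iI : invertible D (ext [set` s] D).
    split; first exact: fractional_seq.
    by exists (ext [set` t] D); [exact: fractional_seq|exact: fg_unit].
  by exists (MkInv iI); rewrite /= ext_ext.
have frs (u : seq K) := fractional_seq (derived_quotient wo hK hTheta d) u.
have nzs (u : seq K) (B : subringClosed K) : nonzero [set` u] -> nonzero (ext [set` u] B).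
  by apply: nonzeroS; exact: sub_ext.
have [||I hI] := invertible_modify_seq (l := l) (derived_quotient wo hK hTheta d)
    (@RT d) (@derived_clears _ _ _ _ _ wo hK hTheta d)
    (@derived_complete _ _ _ _ _ wo hK hTheta d) _
    (frs s) (nzs _ _ ns) (frs t) (nzs _ _ nt).
- by move=> T /hl rT; split; [case: rT|exact: rank_splits].
- move=> S NdS Sl; rewrite !ext_ext; try exact: RT.
  by apply: fg_unit => //; apply: YT; exact: hY.
have [I' eI'] := IHa d da I; exists I'.
(* Members of [l] have rank [d < a], so none is in [N a], where the modified ideal thus agrees with
   [J]. *)
have eT T : N a T -> ext (ext I' (R a)) T = ext J T.
  move=> NaT; have NdT := derived_anti (wltW wo da) NaT.
  rewrite eJ !ext_ext; try exact: RT.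
  rewrite -(ext_ext I' (RT _ _ NdT)) eI' hI ?ext_ext //; first exact: RT.
  by apply/negP => /hl[_ _ /(_ a da)].
have [fI _] := invertible_ext (DR a) (InvP I'); have [fJ _] := InvP J.
apply/seteqP; split=> x hx.
  apply: (derived_complete hK hTheta fJ (invertible_nonzero (InvP J))) => T NaT.
  by rewrite -eT //; exact: sub_ext.
apply: (derived_complete hK hTheta fI _) => [|T NaT].
  exact: invertible_nonzero (invertible_ext (DR a) (InvP I')).
by rewrite eT //; exact: sub_ext.
Qed.

End Lifting.

(** * Direct sums and free abelian groups *)

Lemma additive_of (G H : zmodType) (f : G -> H) : zmod_morphism f ->
  exists g : {additive G -> H}, g =1 f.
Proof.
move=> fB.
by exists (HB.pack_for {additive G -> H} f (GRing.isZmodMorphism.Build G H f fB)).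
Qed.

Lemma isomorphic_sym (G H : zmodType) : isomorphic G H -> isomorphic H G.
Proof.
move=> [f [g fK gK]]; have [h hg] := additive_of (can2_zmod_morphism fK gK).
by exists h; exists f => x; rewrite hg.
Qed.

Lemma free_abelian_isomorphic (G H : zmodType) : isomorphic G H ->
  free_abelian G -> free_abelian H.
Proof.
move=> [f fb] [B [g gb]]; exists B, (f \o g : {additive _ -> _}).
exact: bij_comp.
Qed.

Section DirectSumTheory.
Variables (I : choiceType) (G : I -> zmodType).
Implicit Types (u v : dsum G) (r : seq I).

Definition dsum_at i u : G i := u i.

Fact dsum_at_additive i : zmod_morphism (dsum_at i).
Proof. by []. Qed.

HB.instance Definition _ i :=
  GRing.isZmodMorphism.Build (dsum G) (G i) (dsum_at i) (dsum_at_additive i).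

Lemma dsum_supp u : exists2 r, uniq r & forall i, (i \in r) = (u i != 0).
Proof.
have /finite_seqP[s es] := dsum_finite u; exists (undup s); first exact: undup_uniq.
move=> i; rewrite mem_undup; apply/idP/idP => h.
  by have : [set` s] i by []; rewrite -es.
by have : [set i | u i != 0] i by []; rewrite es.
Qed.

(** The universal property of the direct sum. The formula allows any duplicate-free sequence
    containing the support, so that several elements can be summed over a common one. *)
Lemma dsum_hom (H : zmodType) (h : forall i, {additive G i -> H}) :
  exists phi : {additive dsum G -> H}, forall u r, uniq r ->
    (forall i, u i != 0 -> i \in r) -> phi u = \sum_(i <- r) h i (u i).
Proof.
pose f u := \sum_(i \in [set: I]) h i (u i).
have fE u r : uniq r -> (forall i, u i != 0 -> i \in r) -> f u = \sum_(i <- r) h i (u i).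
  move=> ur hr; rewrite /f (fsbigE r) //.
    by apply: eq_bigl => i; rewrite in_setT.
  by move=> i _; apply: contraNeq => hi; apply: hr; apply: contraNneq hi => ->; rewrite raddf0.
have [|phi hphi] := @additive_of _ _ f.
  move=> u v; have [r _ hr] := dsum_supp u; have [s _ hs] := dsum_supp v.
  have ut := undup_uniq (r ++ s).
  have ru i : u i != 0 -> i \in undup (r ++ s).
    by rewrite mem_undup mem_cat hr => ->.
  have sv i : v i != 0 -> i \in undup (r ++ s).
    by rewrite mem_undup mem_cat hs => ->; rewrite orbT.
  rewrite (fE u _ ut ru) (fE v _ ut sv) (fE (u - v) (undup (r ++ s)) ut).
    by rewrite -sumrB; apply: eq_bigr => i _; rewrite -raddfB.
  move=> i; have [ui|/ru//] := eqVneq (u i) 0; have [vi|/sv//] := eqVneq (v i) 0.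
  by rewrite -[(u - v) i]/(u i - v i) ui vi subr0 eqxx.
by exists phi => u r ur hr; rewrite hphi (fE _ _ ur hr).
Qed.

End DirectSumTheory.

(** * Bases of free abelian groups *)

Section IntBasis.
Variable B : choiceType.
Local Notation F := (dsum (fun _ : B => int)).

Fact basis_finite (b : B) : finite_set [set i | (i == b)%:R != 0 :> int].
Proof.
by apply: (sub_finite_set _ (finite_set1 b)) => i /=; case: (eqVneq i b).
Qed.

Definition basis b : F := Dsum (basis_finite b).

Lemma basis_sum (u : F) r : uniq r -> (forall i, u i != 0 -> i \in r) ->
  u = \sum_(i <- r) basis i *~ u i.
Proof.
move=> ur hr; apply: dsum_ext => j.
rewrite -[RHS]/(dsum_at j _) raddf_sum /=.
under eq_bigr => i _ do rewrite raddfMz.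
have [uj|/hr jr] := eqVneq (u j) 0; last rewrite (bigD1_seq j) //=.
  rewrite uj big1 // => i _; rewrite /dsum_at /=.
  by case: eqVneq => [<-|_]; rewrite ?uj ?mulr0z ?mul0rz.
rewrite big1 => [|i ij]; first by rewrite /dsum_at /= eqxx addr0 intz.
by rewrite /dsum_at /= eq_sym (negPf ij) mul0rz.
Qed.

End IntBasis.

(** [Q] is a subgroup of the product of [F] and [H] projecting onto [F]; a choice of partners for a
    basis extends to a homomorphism whose graph lies in [Q]. *)
Lemma free_lift (F H : zmodType) (Q : F -> H -> Prop) : free_abelian F ->
  Q 0 0 -> (forall x y x' y', Q x y -> Q x' y' -> Q (x - x') (y - y')) ->
  (forall x, exists y, Q x y) ->
  exists s : {additive F -> H}, forall x, Q x (s x).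
Proof.
move=> [B [phi [psi phiK psiK]]] Q0 QB Qex.
have QN x y : Q x y -> Q (- x) (- y).
  by move=> h; have := QB _ _ _ _ Q0 h; rewrite !sub0r.
have QD x y x' y' : Q x y -> Q x' y' -> Q (x + x') (y + y').
  by move=> h /QN h'; have := QB _ _ _ _ h h'; rewrite !opprK.
have QM x y n : Q x y -> Q (x *+ n) (y *+ n).
  by move=> h; elim: n => [|n IHn]; rewrite ?mulr0n // !mulrS; exact: QD.
have QZ x y (n : int) : Q x y -> Q (x *~ n) (y *~ n).
  by case: n => n h; [exact: QM|apply: QN; exact: QM].
have [c hc] := choice (fun b : {classic B} => Qex (phi (basis b))).
have cB b : zmod_morphism (fun n : int => c b *~ n).
  by move=> m n; rewrite mulrzBr.
have [h hE] : {h : forall b : {classic B}, {additive int -> H} & forall b n, h b n = c b *~ n}.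
  exists (fun b => projT1 (cid (additive_of (cB b)))) => b n.
  by case: cid => k /= ->.
have [Phi PhiE] := dsum_hom h.
have [t tE] := additive_of (can2_zmod_morphism phiK psiK).
exists (Phi \o t : {additive _ -> _}) => x; rewrite /= tE.
rewrite -{1}(psiK x); move: (psi x) => u {x}.
have [r ur hr] := @dsum_supp {classic B} _ u.
have hr' i : u i != 0 -> i \in r by rewrite hr.
rewrite (PhiE _ _ ur hr') {1}(basis_sum ur hr') raddf_sum.
apply: (big_ind2 Q) => // i _; rewrite raddfMz hE; exact/QZ/hc.
Qed.

Lemma existT_inj (I : Type) (B : I -> Type) (i : I) : injective (existT B i).
Proof.
by move=> b b' e; have := projT2_eq e; rewrite (Prop_irrelevance (projT1_eq e) erefl).
Qed.

(** The disjoint union of bases of the summands is a basis. *)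
Lemma free_dsum (I : Type) (G : I -> zmodType) :
  (forall i, free_abelian (G i)) -> free_abelian (dsum G).
Proof.
move=> hG.
have hB i : {B : Type & {phi : {additive dsum (fun _ : B => int) -> G i} | bijective phi}}.
  by have [B /cid[phi ?]] := cid (hG i); exists B, phi.
pose B i := projT1 (hB i).
pose phi i : {additive dsum (fun _ : B i => int) -> G i} := sval (projT2 (hB i)).
have [psi psiE] : {psi : forall i, G i -> dsum (fun _ : B i => int) |
    forall i, cancel (phi i) (psi i) /\ cancel (psi i) (phi i)}.
  have h i : {psi : G i -> dsum (fun _ : B i => int) |
      cancel (phi i) psi /\ cancel psi (phi i)}.
    by apply: cid; have [psi ? ?] := svalP (projT2 (hB i)); exists psi.
  by exists (fun i => sval (h i)) => i; exact: svalP (h i).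
pose F := dsum (fun _ : {i & B i} => int); exists {i & B i}.
have fin1 (u : F) i : finite_set [set b | u (existT _ i b) != 0].
  apply: (finite_preimage _ (dsum_finite u)) => b b' _ _; exact: existT_inj.
pose slice (u : F) i : dsum (fun _ : B i => int) := Dsum (fin1 u i).
have fin2 (u : F) : finite_set [set i | phi i (slice u i) != 0].
  apply: (sub_finite_set _ (finite_image (@projT1 I B) (dsum_finite u))).
  move=> i /= nz; apply: contrapT => nex; move/eqP: nz; apply.
  suff -> : slice u i = 0 by rewrite raddf0.
  apply: dsum_ext => b /=; apply/eqP; apply: contra_notT nex => ub.
  by exists (existT _ i b).
have fin3 (v : dsum G) : finite_set
    [set p : {i & B i} | psi (projT1 p) (v (projT1 p)) (projT2 p) != 0].
  have hfin : finite_set (\bigcup_(i in [set i | v i != 0])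
      (existT B i @` [set b | psi i (v i) b != 0])).
    apply: bigcup_finite; first exact: dsum_finite.
    by move=> i _; apply: finite_image; exact: dsum_finite.
  apply: (sub_finite_set _ hfin) => -[i b] /= nz; exists i; last by exists b.
  apply/eqP => vi; move/eqP: nz; apply; rewrite vi.
  by have [phiK _] := psiE i; rewrite -[0 in LHS](raddf0 (phi i)) phiK.
have [|f fE] := @additive_of F (dsum G) (fun u => Dsum (fin2 u)).
  move=> u v; apply: dsum_ext => i /=.
  rewrite -[RHS]/(phi i (slice u i) - phi i (slice v i)) -raddfB.
  by congr (phi i _); exact: dsum_ext.
exists f, (fun v => Dsum (fin3 v)) => [u|v]; rewrite ?fE; apply: dsum_ext.
  by move=> [i b] /=; rewrite (psiE i).1.
move=> i /=; rewrite -[RHS](psiE i).2; congr (phi i _); exact: dsum_ext.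
Qed.

(** * The exact sequence *)

Section ExactSequence.
Variables (K : fieldType) (D : subringClosed K) (Theta : set (subringClosed K)).
Variables (W : Type) (le : rel W) (wo : wochoice.well_order le) (alpha : W).
Hypothesis hK : is_quotient_field D.
Hypothesis hTheta : pre_Jaffard_family D Theta.

Local Notation wlt := (wlt le).
Local Notation N := (derived D Theta wo).
Local Notation R := (derived_ring D Theta wo).
Local Notation rank := (rank D Theta wo).
Local Notation index := (set_type (Theta `\` N alpha)).
Local Notation Inv T := (InvIdeals T : zmodType).
Local Notation DR := (@sub_derived_ring _ _ _ _ _ wo hTheta).

Definition loc (S : subringClosed K) (hS : Theta S) : {additive Inv D -> Inv S} :=
  inv_ext (Theta_sub hTheta hS).

(** Triviality is restated as two inclusions, which can be tested on generators of [x] and of its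
    inverse. *)
Lemma loc0P S (hS : Theta S) (x : InvIdeals D) :
  loc hS x = 0 <-> x `<=` [set` S] /\ Inv_set (- x) `<=` [set` S].
Proof.
have DS := Theta_sub hTheta hS.
split=> [e|[h h']]; last exact: inv_ext0_sub.
have sub (y : InvIdeals D) : loc hS y = 0 -> Inv_set y `<=` [set` S].
  by move=> /inv_ext_eq0 <-; exact: sub_ext.
by split; apply: sub => //; rewrite raddfN e oppr0.
Qed.

Lemma inv_ext_derived0 a (x : InvIdeals D) :
  inv_ext (DR a) x = 0 <-> forall S (hS : Theta S), N a S -> loc hS x = 0.
Proof.
have RS S : N a S -> {subset R a <= S} by exact: derived_ring_sub.
split=> [/inv_ext_eq0 e S hS NaS|h].
  by apply/inv_ext_eq0; rewrite -(ext_ext x (RS S NaS)) e ext_subring //; exact: RS.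
apply: inv_ext0_sub => y hy; apply/derived_ringP => // S NaS;
  have [h1 h2] := (loc0P (derived_sub NaS) x).1 (h S _ NaS); [exact: h1|exact: h2].
Qed.

Lemma loc_inj0 (x : InvIdeals D) : (forall S (hS : Theta S), loc hS x = 0) -> x = 0.
Proof.
move=> h; apply: Inv_ext; have [_ c _ _ _] := hTheta.
rewrite [RHS](c _ (subring_fractional D)) [LHS](c _ (InvP x).1).
apply: eq_bigcapr => S hS; rewrite ext_subring; last exact: (Theta_sub hTheta hS).
exact: (inv_ext_eq0 (Theta_sub hTheta hS) x).1 (h S hS).
Qed.

Hypothesis hfree : forall T, (Theta `\` N alpha) T -> free_abelian (InvIdeals T).

Lemma indexP (i : index) : Theta (sval i) /\ ~ N alpha (sval i).
Proof. by have := set_mem (svalP i). Qed.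

(* [Inv T] being free, the surjection onto it of the group of invertible ideals
   of [D] trivial at the other members of [N r] has a section. *)
Lemma exists_inv_section (i : index) : exists s : {additive Inv (sval i) -> Inv D},
  forall A, loc (indexP i).1 (s A) = A /\
    forall r, rank r (sval i) -> forall S (hS : Theta S), N r S -> S <> sval i ->
      loc hS (s A) = 0.
Proof.
have [hT nT] := indexP i; have [r rT ra] := exists_rank hT nT.
have [NrT _ _] := rT.
apply: (free_lift (Q := fun A x => loc (indexP i).1 x = A /\
    forall r, rank r (sval i) -> forall S (hS : Theta S), N r S -> S <> sval i ->
      loc hS x = 0)).
- exact: hfree.
- by split=> [|r' _ S hS _ _]; rewrite raddf0.
- move=> x y x' y' [e h] [e' h']; split=> [|q rq S hS NqS nST].
    by rewrite raddfB e e'.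
  by rewrite raddfB (h q) // (h' q) // subr0.
move=> A.
have RS S : N r S -> {subset R r <= S} by exact: derived_ring_sub.
have [I [IT IS]] := invertible_modify (derived_quotient wo hK hTheta r) (@RS)
  (@derived_clears _ _ _ _ _ wo hK hTheta r)
  (@derived_complete _ _ _ _ _ wo hK hTheta r) A NrT (rank_splits hK hTheta rT).
have [x ex] := Inv_lift hK hTheta I.
have locx S (hS : Theta S) : N r S -> ext x S = ext I S.
  by move=> NrS; rewrite -ex ext_ext //; exact: RS.
exists x; split=> [|q rq S hS]; first by apply: Inv_ext; rewrite /= locx.
rewrite -(rank_inj rT rq) => NrS nST.
by apply/inv_ext_eq0; rewrite locx // IS.
Qed.

Definition inv_section i : {additive Inv (sval i) -> Inv D} :=
  projT1 (cid (exists_inv_section i)).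

Lemma inv_section_self i A : loc (indexP i).1 (inv_section i A) = A.
Proof. by rewrite /inv_section; case: cid => s hs /=; have [] := hs A. Qed.

Lemma inv_section_other i A r S (hS : Theta S) :
  rank r (sval i) -> N r S -> S <> sval i -> loc hS (inv_section i A) = 0.
Proof.
rewrite /inv_section; case: cid => s hs /= rT NrS nS.
by have [_ h] := hs A; exact: (h r).
Qed.

Lemma locE S (hS hS' : Theta S) : loc hS = loc hS'.
Proof. by rewrite (Prop_irrelevance hS hS'). Qed.

Lemma index_rank (i : index) : exists2 r, rank r (sval i) & wlt r alpha.
Proof. by have [hT nT] := indexP i; exact: exists_rank. Qed.

Lemma exact_sequence :
  exists (f : {additive dsum (fun T : index => Inv (sval T)) -> Inv D})
         (g : {additive Inv D -> Inv (R alpha)}), short_exact f g.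
Proof.
have [f fE] := dsum_hom inv_section.
exists f, (inv_ext (DR alpha)).
have locf S (hS : Theta S) (u : dsum (fun T : index => Inv (sval T))) (r : seq index) :
    uniq r -> (forall i, u i != 0 -> i \in r) ->
    loc hS (f u) = \sum_(i <- r) loc hS (inv_section i (u i)).
  by move=> ur hr; rewrite (fE u r) // raddf_sum.
have range_ker u : inv_ext (DR alpha) (f u) = 0.
  apply/inv_ext_derived0 => S hS NS; have [r ur hr] := dsum_supp u.
  rewrite (locf _ hS u r) // => [|i ui]; last by rewrite hr.
  apply: big1 => i _; have [q rq qa] := index_rank i.
  apply: (inv_section_other _ _ rq); first exact: derived_anti (wltW wo qa) _ NS.
  by move=> e; have [_] := indexP i; rewrite -e.
have rangeD x y : range f x -> range f y -> range f (x + y).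
  by move=> [u _ <-] [v _ <-]; exists (u + v); rewrite ?raddfD.
have range_inv_section i x : range f (inv_section i (loc (indexP i).1 x)).
  pose v (j : index) : Inv (sval j) := if j == i then loc (indexP j).1 x else 0.
  have vi j : v j != 0 -> j = i by rewrite /v; case: (j =P i) => // _; rewrite eqxx.
  have fv : finite_set [set j | v j != 0].
    by apply: (sub_finite_set _ (finite_set1 i)) => j /= /vi.
  exists (Dsum fv) => //; rewrite (fE _ [:: i]) //= ?big_seq1 /= /v ?eqxx //.
  by move=> j /= /vi->; exact: mem_head.
split.
- apply: raddf_inj => u fu0; have [s us hs] := dsum_supp u.
  have hs' i : u i != 0 -> i \in s by rewrite hs.
  have hr (i : index) : i \in s -> exists2 r, rank r (sval i) & le r alpha.
    by move=> _; have [r rT /(wltW wo) ra] := index_rank i; exists r.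
  (* [i] has the largest rank [b] in the support. The other entries have rank at most [b], so their
     sections are trivial at [i] and the component [u i] vanishes, a contradiction. *)
  have [s0|[i [b [si bi hb]]]] := seq_max wo hr.
    apply: dsum_ext => i; apply/eqP; have := hs i; rewrite s0 in_nil => /esym/negbT.
    by rewrite negbK.
  have := locf _ (indexP i).1 _ _ us hs'; rewrite fu0 raddf0 (bigD1_seq i) //=.
  rewrite inv_section_self big1_seq => [|j /andP[ji js]].
    by rewrite addr0 => /esym/eqP; rewrite -[_ == _]negbK -hs si.
  have [q rq qb] := hb j js; apply: (inv_section_other _ _ rq).
    by have [NbT _ _] := bi; exact: derived_anti NbT.
  by move=> e; move/eqP: ji; apply; apply: val_inj.
- apply/seteqP; split=> [_ [u _ <-]|x /inv_ext_derived0]; first exact: range_ker.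
  (* Induction on an index [a] at most [alpha] such that [x] is trivial on [N a]; the bound ensures
     that members of rank below [a] are outside [N alpha]. *)
  have : le alpha alpha by exact: wo_refl.
  elim/(well_founded_ind (wlt_wf wo)): {1 3}alpha x => a IHa x aalpha hx.
  have [s [s' [es _ _]]] := invertible_fg x.
  have [t [t' [et _ _]]] := invertible_fg (- x).
  have locY S (hS : Theta S) : loc hS x = 0 <-> {subset s ++ t <= S}.
    rewrite loc0P es et; split=> [[h h'] y|h].
      by rewrite mem_cat => /orP[ys|yt]; [apply: h|apply: h']; exact: sub_ext.
    have mS : submodule D [set` S] by exact: submodule_subring (Theta_sub hTheta hS).
    by split; apply: ext_least => // y ys; apply: h; rewrite mem_cat ys ?orbT.
  have hYa T : N a T -> {subset s ++ t <= T}.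
    by move=> NaT; apply/(locY T (derived_sub NaT))/hx.
  have [hY|[d [l [da hl hY]]]] := descend hK hTheta hYa.
    exists 0 => //; rewrite raddf0; apply/esym/loc_inj0 => S hS.
    by apply/locY; exact: hY.
  have dalpha : le d alpha by exact: wo_trans (wltW wo da) aalpha.
  (* [y] is a sum of sections at the entries of [l]: on [N d] it agrees with [x] at [l] and is
     trivial elsewhere, so [x - y] is trivial on [N d]. *)
  have [y fy hy] : exists2 y, range f y & forall S (hS : Theta S), N d S ->
      loc hS y = if S \in l then loc hS x else 0.
    elim: l hl {hY} => [|T l IHl] hl.
      by exists 0 => [|S hS _]; [exists 0; rewrite ?raddf0|rewrite raddf0].
    have [|y fy hy] := IHl; first by move=> S Sl; apply: hl; rewrite inE Sl orbT.
    (* A repeated entry of [l] contributes only once. *)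
    have [Tl|Tl] := boolP (T \in l).
      exists y => // S hS NdS; rewrite hy // inE; case: (S =P T) => [eST|//].
      by have -> : S \in l by rewrite eST.
    have rT := hl T (mem_head _ _); have [NdT _ nT] := rT.
    have hT : (Theta `\` N alpha) T.
      split; first exact: derived_sub NdT.
      by apply: nT; exact: wlt_le_trans da aalpha.
    pose i : index := exist _ T (mem_set hT).
    exists (y + inv_section i (loc (indexP i).1 x)); first exact/rangeD/range_inv_section.
    move=> S hS NdS; rewrite raddfD hy // inE; have [eST|nST] := eqVneq S T.
      move: hS NdS; rewrite eST => hS NdS; rewrite (negPf Tl) add0r.
      rewrite (locE hS (indexP i).1); exact: (@inv_section_self i _).
    by rewrite (@inv_section_other i _ d S hS rT NdS) ?addr0 //; exact/eqP.
  rewrite -(subrK y x); apply: rangeD => //; apply: IHa da _ dalpha _ => S hS NdS.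
  rewrite raddfB hy //; case: ifPn => [_|/(hY S NdS)/(locY S hS) ->]; first exact: subrr.
  exact: subr0.
- apply/seteqP; split=> // J _; have [x ex] := Inv_lift hK hTheta J.
  by exists x => //; exact: Inv_ext.
Qed.

End ExactSequence.

(** * The sharp case and the conclusion *)

Lemma short_exact_isomorphic (F G H : zmodType) (f : {additive F -> G})
  (g : {additive G -> H}) : short_exact f g -> (forall z : H, z = 0) ->
  isomorphic F G.
Proof.
move=> [finj frange _] H0; exists f.
have hf x : exists y, f y = x.
  have : [set x | g x = 0] x by exact: H0.
  by rewrite -frange => -[y _ <-]; exists y.
have [h hE] := choice hf; exists h => // x.
by apply: finj; rewrite hE.
Qed.

Lemma InvIdeals_field (K : fieldType) (A : subringClosed K) (I : InvIdeals A) :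
  [set` A] = setT -> I = 0.
Proof.
move=> AT; apply: Inv_ext; rewrite /= AT; apply/seteqP; split=> // x _.
have [x0 Ix0 nx0] := invertible_nonzero (InvP I).
have [[[_ _ IZ] _] _] := InvP I.
rewrite -(divfK nx0 x); apply: IZ => //.
by have : [set` A] (x / x0) by rewrite AT.
Qed.

Theorem proposition5p2 (K : fieldType) (D : subringClosed K)
    (Theta : set (subringClosed K))
    (W : Type) (le : rel W) (wo : wochoice.well_order le) (alpha : W)
    (hK : is_quotient_field D) (hD : ~ is_field D)
    (hTheta : pre_Jaffard_family D Theta)
    (hfree : forall T : subringClosed K,
       (Theta `\` derived D Theta wo alpha) T -> free_abelian (InvIdeals T)) :
  (exists (f : {additive
                 dsum (fun T : set_type (Theta `\` derived D Theta wo alpha) =>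
                         InvIdeals (sval T) : zmodType)
                 -> InvIdeals D})
          (g : {additive InvIdeals D -> InvIdeals (derived_ring D Theta wo alpha)}),
     short_exact f g) /\
  (sharp D Theta ->
   (exists2 b : W, is_Jaffard_degree D Theta wo b & le b alpha) ->
   isomorphic (InvIdeals D) (dsum (fun T : set_type Theta => InvIdeals (sval T) : zmodType)) /\
   free_abelian (InvIdeals D)).
Proof.
have ex := exact_sequence hK hTheta hfree; split=> // _ [b [Kb _] ba].
have Ka : [set` derived_ring D Theta wo alpha] = setT.
  apply/seteqP; split=> // x _; apply: (derived_ringS hTheta ba).
  by have : [set` derived_ring D Theta wo b] x by rewrite Kb.
(* Members of [Theta] differ from [K], and those of [N alpha] contain [T_alpha = K]; so [N alpha] is
   empty. *)
have Na : derived D Theta wo alpha = set0.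
  apply/seteqP; split=> // T NT; have [_ _ _ _ /(_ T (derived_sub NT))] := hTheta.
  apply; apply/seteqP; split=> // x _; apply: (derived_ring_sub hTheta NT).
  by have : [set` derived_ring D Theta wo alpha] x by rewrite Ka.
have [f [g fg]] := ex.
have := short_exact_isomorphic fg (fun z => InvIdeals_field z Ka).
move: hfree; rewrite Na setD0 => hfree' iso; split; first exact: isomorphic_sym.
apply: free_abelian_isomorphic iso _; apply: free_dsum => i.
by apply: hfree'; exact: (set_mem (svalP i)).
Qed.
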